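(* Let $(M_1,g_1)$ and $(M_2,g_2)$ be Riemannian manifolds, $f_i:M_i\to(0,\infty)$ ($i=1,2$) smooth positive functions and $c\in\mathbb{R}$ such that $0\le c^2\, g_1(\mathrm{grad} f_1,\mathrm{grad} f_1)(p_1)\; g_2(\mathrm{grad} f_2,\mathrm{grad} f_2)(p_2)<1$ for all $(p_1,p_2)\in M_1\times M_2$. Let $\overset{i}{\nabla}$ be an affine connection on $M_i$ ($i=1,2$), let $G_{f_1f_2}$ be the generalized warped product metric on $M_1\times M_2$, and let $\nabla$ be the affine connection on $M_1\times M_2$ induced by $\overset{1}{\nabla}$ and $\overset{2}{\nabla}$ (defined in the context). Then $(M_1,\overset{1}{\nabla},g_1)$ and $(M_2,\overset{2}{\nabla},g_2)$ are statistical manifolds if and only if $(M_1\times M_2,G_{f_1f_2},\nabla)$ is a statistical manifold.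
   Context: Statistical manifold: for an affine connection $\nabla$ and a (pseudo-)Riemannian metric $g$ on $M$, $(M,\nabla,g)$ is a statistical manifold if $\nabla$ is torsion-free and $\nabla g$ is symmetric, i.e. $(\nabla g)(X,Y,Z):=X(g(Y,Z))-g(\nabla_XY,Z)-g(Y,\nabla_XZ)$ satisfies $(\nabla g)(X,Y,Z)=(\nabla g)(Y,X,Z)$ for all vector fields $X,Y,Z$. Lifts: $\pi_i:M_1\times M_2\to M_i$ are the projections. For a function $\varphi$ on $M_1$ (resp. $M_2$), $\varphi^h=\varphi\circ\pi_1$ (resp. $\varphi^v=\varphi\circ\pi_2$). For $X_1\in\Gamma(TM_1)$, the horizontal lift $X_1^h$ is the vector field on $M_1\times M_2$ that is $\pi_1$-related to $X_1$ and $\pi_2$-related to $0$; for $X_2\in\Gamma(TM_2)$, the vertical lift $X_2^v$ is $\pi_2$-related to $X_2$ and $\pi_1$-related to $0$. Generalized warped product metric: $$G_{f_1f_2}=(f_2^v)^2\pi_1^*g_1+(f_1^h)^2\pi_2^*g_2+c f_1^hf_2^v\,(df_1^h\otimes df_2^v+df_2^v\otimes df_1^h),$$ a Riemannian metric under the stated inequality. The gradient $\mathrm{grad} f_i$ is with respect to $g_i$; $\mathrm{grad}(f_1^h)$ and $\mathrm{grad}(f_2^v)$ denote gradients on $M_1\times M_2$ with respect to $G_{f_1f_2}$. Induced connection: for $X_i,Y_i\in\Gamma(TM_i)$ put $$B_{f_i}(X_i,Y_i)=cf_i\{X_i(Y_i(f_i))-(\overset{i}{\nabla}_{X_i}Y_i)(f_i)\}+cX_i(f_i)Y_i(f_i)-g_i(X_i,Y_i).$$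 The connection $\nabla$ on $M_1\times M_2$ induced by $\overset{1}{\nabla},\overset{2}{\nabla}$ is the affine connection determined on lifts by $$\nabla_{X_1^h}Y_1^h=(\overset{1}{\nabla}_{X_1}Y_1)^h+f_2^v\,B_{f_1}(X_1,Y_1)^h\,\mathrm{grad}(f_2^v),$$ $$\nabla_{X_2^v}Y_2^v=(\overset{2}{\nabla}_{X_2}Y_2)^v+f_1^h\,B_{f_2}(X_2,Y_2)^v\,\mathrm{grad}(f_1^h),$$ $$\nabla_{X_1^h}Y_2^v=\nabla_{Y_2^v}X_1^h=-cX_1(f_1)^hY_2(f_2)^v\{f_2^v\,\mathrm{grad}(f_1^h)+f_1^h\,\mathrm{grad}(f_2^v)\}+(Y_2(\ln f_2))^vX_1^h+(X_1(\ln f_1))^hY_2^v.$$ *)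

(* Defs.v *)
From HB Require Import structures.
From mathcomp Require Import all_boot all_order all_algebra.
From mathcomp Require Import all_classical all_reals all_analysis.
Set Implicit Arguments.
Unset Strict Implicit.
Unset Printing Implicit Defensive.
Import Order.TTheory GRing.Theory Num.Theory.
Import numFieldNormedType.Exports.
Local Open Scope classical_set_scope.
Local Open Scope ring_scope.

Section Ck.
Context {R : realType}.

(* [Ck k U f]: [f] is of class C^k on the open set [U]; the values of [f]
   outside [U] are irrelevant. *)
Fixpoint Ck (k : nat) (n : nat) (U : set 'rV[R]_n) (f : 'rV[R]_n -> R) : Prop :=
  match k with
  | 0 => forall x, U x -> {for x, continuous f}
  | k'.+1 => (forall x, U x -> differentiable f x) /\
             (forall v : 'rV[R]_n, Ck k' U ('D_v f))
  end.

Definition smooth_on n (U : set 'rV[R]_n) (f : 'rV[R]_n -> R) : Prop :=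
  forall k, Ck k U f.

Definition smooth_map_on m n (U : set 'rV[R]_m) (F : 'rV[R]_m -> 'rV[R]_n) :=
  forall j, smooth_on U (fun x => F x ord0 j).

Lemma near_differentiable (V W : normedModType R) (f g : V -> W) x :
  (\forall y \near x, f y = g y) -> differentiable f x -> differentiable g x.
Proof.
move=> fg /[dup] df /diff_locallyP[cdf dfe].
have fgx : f x = g x by exact: nbhs_singleton fg.
have H : g \o shift x = cst (g x) + 'd f x +o_ (0 : V) id.
  apply/eqaddoP => e e0.
  move/eqaddoP : dfe => /(_ e e0) dfe.
  have fg0 : \forall y \near (0 : V), f (y + x) = g (y + x).
    have c : (fun y : V => y + x) @ (0 : V) --> x.
      by rewrite -[X in _ --> X]add0r; apply: cvgD; [exact: cvg_id|exact: cvg_cst].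
    exact: c _ fg.
  near=> y.
  have <- : (f \o shift x - (cst (f x) + 'd f x)) y = (g \o shift x - (cst (g x) + 'd f x)) y.
    rewrite /= !fctE /= fgx; congr (_ - _).
    by near: y.
  by near: y.
apply/diff_locallyP.
by rewrite (diff_unique cdf H).
Unshelve. all: by end_near. Qed.

Lemma near_open n (U : set 'rV[R]_n) (x : 'rV[R]_n) T (f g : 'rV[R]_n -> T) :
  open U -> U x -> (forall y, U y -> f y = g y) -> \forall y \near x, f y = g y.
Proof.
move=> oU Ux fg; near=> y; apply: fg; near: y; exact: open_nbhs_nbhs.
Unshelve. all: by end_near. Qed.

Lemma near_continuous (S T : topologicalType) (f g : S -> T) x :
  (\forall y \near x, f y = g y) -> {for x, continuous f} -> {for x, continuous g}.
Proof.
move=> fg cf; have fgx : f x = g x by exact: nbhs_singleton fg.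
have : g @ x --> f x; last by rewrite fgx.
apply: cvg_trans cf; exact: near_eq_cvg.
Unshelve. all: by end_near. Qed.

Lemma Ck_eq k n (U : set 'rV[R]_n) f g :
  open U -> (forall x, U x -> f x = g x) -> Ck k U f -> Ck k U g.
Proof.
move=> oU; elim: k f g => [|k IH] f g fg /=.
  by move=> cf x Ux; apply: near_continuous (cf x Ux); exact: near_open fg.
move=> [df Df]; split=> [x Ux|v].
  by apply: near_differentiable (df x Ux); exact: near_open fg.
by apply: IH (Df v) => x Ux; apply: near_eq_derive; exact: near_open fg.
Qed.

Lemma Ck_sub k n (U V : set 'rV[R]_n) f : V `<=` U -> Ck k U f -> Ck k V f.
Proof.
move=> VU; elim: k f => [|k IH] f /=; first by move=> cf x /VU /cf.
by move=> [df Df]; split=> [x /VU /df//|v]; exact: IH.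
Qed.

Lemma Ck_continuous k n (U : set 'rV[R]_n) f x :
  Ck k U f -> U x -> {for x, continuous f}.
Proof.
case: k => [/(_ x)//|k [df _] Ux].
exact/differentiable_continuous/df.
Qed.

Lemma CkS k n (U : set 'rV[R]_n) f : Ck k.+1 U f -> Ck k U f.
Proof.
elim: k f => [|k IH] f; first by move=> H x; exact: Ck_continuous H.
by move=> [df Df]; split=> // v; apply: IH; exact: Df.
Qed.

Lemma Ck_cst k n (U : set 'rV[R]_n) (c : R) : Ck k U (fun=> c).
Proof.
elim: k c => [|k IH] c; first by move=> x _; exact: cst_continuous.
split=> [x _|v]; first exact: differentiable_cst.
have -> : 'D_v (fun=> c) = fun=> (0 : R); last exact: IH.
by apply/funext => x; exact: derive_cst.
Qed.

Lemma CkD k n (U : set 'rV[R]_n) f g : open U ->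
  Ck k U f -> Ck k U g -> Ck k U (fun x => f x + g x).
Proof.
move=> oU; elim: k f g => [|k IH] f g.
  by move=> cf cg x Ux; apply: continuousD; [exact: cf|exact: cg].
move=> [df Df] [dg Dg]; split=> [x Ux|v].
  by apply: differentiableD; [exact: df|exact: dg].
apply: Ck_eq (IH _ _ (Df v) (Dg v)) => // x Ux.
by rewrite -deriveD //; apply: diff_derivable; [exact: df|exact: dg].
Qed.

Lemma CkM k n (U : set 'rV[R]_n) f g : open U ->
  Ck k U f -> Ck k U g -> Ck k U (fun x => f x * g x).
Proof.
move=> oU; elim: k f g => [|k IH] f g.
  by move=> cf cg x Ux; apply: continuousM; [exact: cf|exact: cg].
move=> /[dup] Cf [df Df] /[dup] Cg [dg Dg]; split=> [x Ux|v].
  by apply: differentiableM; [exact: df|exact: dg].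
have := CkD oU (IH _ _ (CkS Cf) (Dg v)) (IH _ _ (CkS Cg) (Df v)).
apply: Ck_eq => // x Ux.
have := @deriveM _ _ f g x v; rewrite /GRing.scale /= => -> //.
  by apply: diff_derivable; exact: df.
by apply: diff_derivable; exact: dg.
Qed.

Lemma Ck_sum k n (U : set 'rV[R]_n) m (F : 'I_m -> 'rV[R]_n -> R) : open U ->
  (forall i, Ck k U (F i)) -> Ck k U (fun x => \sum_(i < m) F i x).
Proof.
move=> oU; elim: m F => [|m IH] F CF.
  by apply: Ck_eq (Ck_cst k U 0) => // x _; rewrite big_ord0.
apply: Ck_eq (CkD oU (CF ord0) (IH _ (fun i => CF (lift ord0 i)))) => // x _.
by rewrite big_ord_recl.
Qed.

Lemma CkV k n (U : set 'rV[R]_n) f : open U -> (forall x, U x -> f x != 0) ->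
  Ck k U f -> Ck k U (fun x => (f x)^-1).
Proof.
move=> oU f0; elim: k => [|k IH].
  by move=> cf x Ux; apply: continuousV; [exact: f0|exact: cf].
move=> /[dup] Cf [df Df]; split=> [x Ux|v].
  by apply: differentiableV; [exact: df|exact: f0].
have Cfi := IH (CkS Cf).
apply: Ck_eq (CkM oU (CkM oU (Ck_cst _ _ (-1)) (CkM oU Cfi Cfi)) (Df v)) => // x Ux.
have := @deriveV _ _ f x v (f0 _ Ux); rewrite /GRing.scale /= => ->.
  by rewrite mulN1r -expr2 exprVn.
by apply: diff_derivable; exact: df.
Qed.

Lemma is_diff_ln (x : R) : 0 < x -> is_diff x (@ln R) ( *%R x^-1).
Proof.
move=> x0; have [dl le] := is_derive1_ln x0.
apply: DiffDef; first exact/derivable1_diffP.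
by rewrite deriv1E //; apply/funext => y; rewrite derive1E le /GRing.scale/= mulrC.
Qed.

Lemma Ck_ln k n (U : set 'rV[R]_n) f : open U -> (forall x, U x -> 0 < f x) ->
  Ck k U f -> Ck k U (fun x => ln (f x)).
Proof.
move=> oU f0; case: k => [|k].
  move=> cf x Ux; apply: (@continuous_comp _ _ _ f (@ln R)); first exact: cf.
  exact: continuous_ln (f0 _ Ux).
move=> /[dup] Cf [df Df].
have dl x : U x -> is_diff x (fun x => ln (f x)) (( *%R (f x)^-1) \o 'd f x).
  move=> Ux; have := is_diff_ln (f0 _ Ux).
  by apply: is_diff_comp; apply: differentiableP; exact: df.
split=> [x Ux|v]; first by have [] := dl _ Ux.
have f1 x : U x -> f x != 0 by move=> /f0; rewrite lt0r => /andP[].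
apply: Ck_eq (CkM oU (CkV oU f1 (CkS Cf)) (Df v)) => // x Ux.
have [H1 H2] := dl _ Ux.
by rewrite (deriveE _ H1) H2 /= deriveE //; exact: df.
Qed.

Lemma row_sumE (V : Type) n (F : V -> 'rV[R]_n) :
  F = (fun x => \sum_(j < n) F x ord0 j *: delta_mx ord0 j).
Proof. by apply/funext => x; rewrite {1}(row_sum_delta (F x)). Qed.

Lemma differentiable_row (V : normedModType R) n (F : V -> 'rV[R]_n) x :
  (forall j, differentiable (fun x => F x ord0 j) x) -> differentiable F x.
Proof.
move=> dF; rewrite (row_sumE F).
have -> : (fun x => \sum_(j < n) F x ord0 j *: delta_mx ord0 j) =
  \sum_(j < n) (fun x => F x ord0 j *: (delta_mx ord0 j : 'rV[R]_n)).
  by rewrite fct_sumE.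
by apply: differentiable_sum => j; exact: differentiableZl.
Qed.

Lemma derive_row (V : normedModType R) n (F : V -> 'rV[R]_n) x v j :
  differentiable F x -> 'D_v (fun x => F x ord0 j) x = ('D_v F x) ord0 j.
Proof. by move=> dF; rewrite derive_mx ?mxE //; exact: diff_derivable. Qed.

Lemma derive_comp m n (f : 'rV[R]_n -> R) (F : 'rV[R]_m -> 'rV[R]_n) x v :
  differentiable F x -> differentiable f (F x) ->
  'D_v (f \o F) x = 'D_('D_v F x) f (F x).
Proof.
move=> dF df; rewrite deriveE; last exact: differentiable_comp.
by rewrite diff_comp // /= !deriveE.
Qed.

Lemma derive_coord n (f : 'rV[R]_n -> R) x (v : 'rV[R]_n) : differentiable f x ->
  'D_v f x = \sum_j v ord0 j * 'D_(delta_mx ord0 j) f x.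
Proof.
move=> df; rewrite deriveE // {1}(row_sum_delta v) raddf_sum.
by apply: eq_bigr => j _; rewrite [LHS]linearZ /= deriveE.
Qed.

Lemma Ck_comp k m n (U : set 'rV[R]_n) (V : set 'rV[R]_m)
    (f : 'rV[R]_n -> R) (F : 'rV[R]_m -> 'rV[R]_n) :
  open V -> (forall x, V x -> U (F x)) ->
  (forall j, Ck k V (fun x => F x ord0 j)) -> Ck k U f -> Ck k V (f \o F).
Proof.
move=> oV VU; elim: k f => [|k IH] f CF.
  move=> cf x Vx; apply: continuous_comp; last by apply: cf; exact: VU.
  apply: (@near_continuous _ _ (fun x => \row_j F x ord0 j)).
    by near=> y; apply/rowP => j; rewrite mxE.
  move=> A [P nP PA].
  have : \forall y \near x, forall j, P ord0 j (F y ord0 j).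
    apply: (filter_forall (F := nbhs x) (f := fun j y => P ord0 j (F y ord0 j))) => j; have := nP ord0 j; rewrite mxE => H.
    exact: (CF j x Vx _ H).
  by apply: filterS => y Py; apply: PA => i j; rewrite mxE (ord1 i); exact: Py.
move=> [df Df].
have dF x : V x -> differentiable F x.
  by move=> Vx; apply: differentiable_row => j; apply: (CF j).1.
split=> [x Vx|v].
  by apply: differentiable_comp; [exact: dF|apply: df; exact: VU].
have C1 j : Ck k V (fun x => 'D_v (fun x => F x ord0 j) x *
                       ('D_(delta_mx ord0 j) f \o F) x).
  apply: CkM => //; first exact: (CF j).2.
  by apply: IH; [move=> i; exact: CkS|exact: Df].
apply: Ck_eq (Ck_sum oV C1) => // x Vx.
rewrite derive_comp; [|exact: dF|by apply: df; exact: VU].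
rewrite derive_coord; last by apply: df; exact: VU.
by apply: eq_bigr => j _; rewrite derive_row //; exact: dF.
Unshelve. all: by end_near. Qed.

Lemma Ck_coord k n (U : set 'rV[R]_n) j : Ck k U (fun x => x ord0 j).
Proof.
case: k => [|k]; first by move=> x _; exact: coord_continuous.
split=> [x _|v]; first exact: differentiable_coord.
have -> : 'D_v (fun x : 'rV[R]_n => x ord0 j : R) = fun=> v ord0 j;
  last exact: Ck_cst.
apply/funext => x.
by rewrite derive_row // derive_id.
Qed.

Lemma Ck_local k n (U : set 'rV[R]_n) f :
  (forall x, U x -> exists V, [/\ open V, V x & Ck k V f]) -> Ck k U f.
Proof.
elim: k f => [|k IH] f H; first by move=> x /H[V [_ Vx /(_ x Vx)]].
split=> [x /H[V [_ Vx [df _]]]|v]; first exact: df.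
apply: IH => x /H[V [oV Vx [_ Df]]]; exists V; split=> //; exact: Df.
Qed.

End Ck.

(* A chart is a homeomorphism of an open set [chart_dom] of [M] onto an open set
   of R^n, with inverse [chart_inv]; both maps are total functions whose values
   outside these sets are irrelevant. *)
Record chart (R : realType) (n : nat) (M : topologicalType) := Chart {
  chart_dom : set M;
  chart_map :> M -> 'rV[R]_n;
  chart_inv : 'rV[R]_n -> M;
  chart_dom_open : open chart_dom;
  chart_cod_open : open (chart_map @` chart_dom);
  chart_mapK : forall p, chart_dom p -> chart_inv (chart_map p) = p;
  chart_map_continuous :
    forall p, chart_dom p -> {for p, continuous chart_map};
  chart_inv_continuous :
    forall x, (chart_map @` chart_dom) x -> {for x, continuous chart_inv} }.

Definition chart_cod R n (M : topologicalType) (a : chart R n M) : set 'rV[R]_n :=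
  a @` chart_dom a.

(* The atlas need not be maximal.  Manifolds are nonempty by convention: if one
   factor of a product were empty, the product would carry no information on the
   other factor.  Connectedness is not required. *)
Record manifold (R : realType) := Manifold {
  carrier :> topologicalType;
  dim : nat;
  atlas : set (chart R dim carrier);
  manifold_nonempty : [set: carrier] !=set0;
  manifold_hausdorff : hausdorff_space carrier;
  manifold_second_countable : @second_countable carrier;
  atlas_cover : forall p : carrier, exists2 a, atlas a & chart_dom a p;
  atlas_smooth : forall a b, atlas a -> atlas b ->
    smooth_map_on (a @` (chart_dom a `&` chart_dom b)) (b \o chart_inv a) }.

Arguments atlas {R}.

Section Charts.
Context {R : realType}.

Lemma chart_codP n (M : topologicalType) (a : chart R n M) p :
  chart_dom a p -> chart_cod a (a p).
Proof. by exists p. Qed.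

Lemma chart_invP n (M : topologicalType) (a : chart R n M) x :
  chart_cod a x -> chart_dom a (chart_inv a x) /\ a (chart_inv a x) = x.
Proof. by case=> p ap <-; rewrite chart_mapK. Qed.

Lemma chart_image_open n (M : topologicalType) (a : chart R n M) (W : set M) :
  open W -> open (a @` (chart_dom a `&` W)).
Proof.
move=> oW; rewrite openE => x [p [ap Wp] <-]; rewrite /interior.
have n1 : \forall y \near a p, chart_cod a y.
  by apply: open_nbhs_nbhs; split; [exact: chart_cod_open|exact: chart_codP].
have n2 : \forall y \near a p, W (chart_inv a y).
  apply: (chart_inv_continuous (chart_codP ap)).
  by rewrite chart_mapK //; exact: open_nbhs_nbhs.
near=> y.
have ay : chart_cod a y by near: y.
have Wy : W (chart_inv a y) by near: y.
by have [H1 H2] := chart_invP ay; exists (chart_inv a y).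
Unshelve. all: by end_near. Qed.

Definition smooth (M : manifold R) (f : M -> R) : Prop :=
  forall a, atlas M a -> smooth_on (chart_cod a) (f \o chart_inv a).

Section SmoothFun.
Variable M : manifold R.

Lemma cod_open (a : chart R (dim M) M) : open (chart_cod a).
Proof. exact: chart_cod_open. Qed.
Arguments cod_open : clear implicits.

Definition smooth_pred : {pred M -> R} := fun f => `[< smooth f >].

Lemma smooth_subring : subring_closed smooth_pred.
Proof.
split.
- by apply/asboolP => a _ k; exact: Ck_cst.
- move=> f g /asboolP sf /asboolP sg; apply/asboolP => a aM k.
  have := CkD (cod_open a) (sf a aM k)
    (CkM (cod_open a) (Ck_cst k _ (-1)) (sg a aM k)).
  by apply: Ck_eq => [|x _]; [exact: cod_open|rewrite mulN1r].
- move=> f g /asboolP sf /asboolP sg; apply/asboolP => a aM k.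
  exact: CkM (cod_open a) (sf a aM k) (sg a aM k).
Qed.

Lemma smooth_submod : GRing.subsemimod_closed smooth_pred.
Proof.
split; first exact: GRing.zmod_closedD (GRing.subring_closedB smooth_subring).
move=> c f /asboolP sf; apply/asboolP => a aM k.
exact: CkM (cod_open a) (Ck_cst k _ c) (sf a aM k).
Qed.

(* The algebra C^oo(M). *)
Record smooth_fun := SmoothFun {
  smooth_val :> M -> R;
  smooth_valP : smooth_pred smooth_val }.

HB.instance Definition _ := [isSub for smooth_val].
HB.instance Definition _ := [Choice of smooth_fun by <:].
HB.instance Definition _ :=
  GRing.SubChoice_isSubComPzRing.Build (M -> R) smooth_pred smooth_fun
    smooth_subring.
HB.instance Definition _ := GRing.SubZmodule_isSubLmodule.Build
  R (M -> R) smooth_pred smooth_fun smooth_submod.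

Lemma smooth_funP (f : smooth_fun) : smooth f.
Proof. by apply/asboolP; exact: smooth_valP. Qed.

Lemma smooth_fun_ext (f g : smooth_fun) : (forall p, f p = g p) -> f = g.
Proof. by move=> fg; apply/val_inj/funext. Qed.

Definition mk_smooth (f : M -> R) (sf : smooth f) : smooth_fun :=
  SmoothFun (asboolT sf : smooth_pred f).

End SmoothFun.
End Charts.
Arguments cod_open {R M} a.

Section Tangent.
Context {R : realType}.
Variable M : manifold R.

(* The tangent vector at [p] with components [xi] in the chart [a], as an operator
   on smooth functions. *)
Definition chart_deriv (a : chart R (dim M) M) (p : M) (xi : 'rV[R]_(dim M))
  (f : smooth_fun M) : R := 'D_xi (f \o chart_inv a) (a p).

(* Tangent vectors are directional derivatives.  As coordinate changes are smooth,
   having components in one chart around [p] is the same as having components in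
   every chart around [p] (see [chart_tangent] below). *)
Record tangent (p : M) := Tangent {
  tangent_val :> smooth_fun M -> R;
  tangentP : forall a, atlas M a -> chart_dom a p ->
    exists xi, tangent_val =1 chart_deriv a p xi }.

HB.instance Definition _ p := gen_eqMixin (tangent p).
HB.instance Definition _ p := gen_choiceMixin (tangent p).

Lemma tangent_ext p (u v : tangent p) : (forall f, u f = v f) -> u = v.
Proof.
case: u v => [u Pu] [v Pv] /= /funext uv; rewrite -uv in Pv *.
by congr Tangent; exact: Prop_irrelevance.
Qed.

Lemma chart_diff (a : chart R (dim M) M) p (f : smooth_fun M) :
  atlas M a -> chart_dom a p -> differentiable (f \o chart_inv a) (a p).
Proof.
by move=> aM ap; have [+ _] := smooth_funP f aM 1; apply; exact: chart_codP.
Qed.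

Lemma chart_derivZ (a : chart R (dim M) M) p f xi c :
  atlas M a -> chart_dom a p ->
  chart_deriv a p (c *: xi) f = c * chart_deriv a p xi f.
Proof.
move=> aM ap; rewrite /chart_deriv !deriveE; try exact: chart_diff.
by rewrite [LHS]linearZ.
Qed.

Lemma chart_derivD (a : chart R (dim M) M) p f xi eta :
  atlas M a -> chart_dom a p ->
  chart_deriv a p (xi + eta) f = chart_deriv a p xi f + chart_deriv a p eta f.
Proof.
move=> aM ap; rewrite /chart_deriv !deriveE; try exact: chart_diff.
by rewrite [LHS]linearD.
Qed.

Section TangentSpace.
Variable p : M.
Implicit Types u v : tangent p.

Program Definition tangent0 : tangent p := @Tangent p (fun=> 0) _.
Next Obligation.
by move=> a aM ap; exists 0 => f; rewrite /chart_deriv derive0.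
Qed.

Program Definition tangentD u v : tangent p :=
  @Tangent p (fun f => u f + v f) _.
Next Obligation.
move=> u v a aM ap.
have [xi uE] := tangentP u aM ap; have [eta vE] := tangentP v aM ap.
by exists (xi + eta) => f; rewrite chart_derivD // uE vE.
Qed.

Program Definition tangentZ (c : R) u : tangent p :=
  @Tangent p (fun f => c * u f) _.
Next Obligation.
move=> c u a aM ap; have [xi uE] := tangentP u aM ap.
by exists (c *: xi) => f; rewrite chart_derivZ // uE.
Qed.

Lemma tangentDA : associative tangentD.
Proof. by move=> u v w; apply: tangent_ext => f /=; rewrite addrA. Qed.
Lemma tangentDC : commutative tangentD.
Proof. by move=> u v; apply: tangent_ext => f /=; rewrite addrC. Qed.
Lemma tangent0D : left_id tangent0 tangentD.
Proof. by move=> u; apply: tangent_ext => f /=; rewrite add0r. Qed.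
Lemma tangentND : left_inverse tangent0 (tangentZ (-1)) tangentD.
Proof. by move=> u; apply: tangent_ext => f /=; rewrite mulN1r addNr. Qed.
HB.instance Definition _ := GRing.isZmodule.Build (tangent p)
  tangentDA tangentDC tangent0D tangentND.

Lemma tangentZA c d u : tangentZ c (tangentZ d u) = tangentZ (c * d) u.
Proof. by apply: tangent_ext => f /=; rewrite mulrA. Qed.
Lemma tangent1Z : left_id 1 tangentZ.
Proof. by move=> u; apply: tangent_ext => f /=; rewrite mul1r. Qed.
Lemma tangentZDr : right_distributive tangentZ +%R.
Proof. by move=> c u v; apply: tangent_ext => f /=; rewrite mulrDr. Qed.
Lemma tangentZDl u : {morph tangentZ^~ u : c d / c + d}.
Proof. by move=> c d; apply: tangent_ext => f /=; rewrite mulrDl. Qed.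
HB.instance Definition _ := GRing.Zmodule_isLmodule.Build R (tangent p)
  tangentZA tangent1Z tangentZDr tangentZDl.

End TangentSpace.

(* A vector field is smooth when its components in every chart are.  Vector fields
   form a module over [smooth_fun M]. *)
Record vfield := Vfield {
  vfield_val :> forall p, tangent p;
  vfieldP : forall a, atlas M a ->
    exists2 Xi : 'rV[R]_(dim M) -> 'rV[R]_(dim M),
      smooth_map_on (chart_cod a) Xi &
      forall p, chart_dom a p -> vfield_val p =1 chart_deriv a p (Xi (a p)) }.

HB.instance Definition _ := gen_eqMixin vfield.
HB.instance Definition _ := gen_choiceMixin vfield.

Lemma vfield_ext (X Y : vfield) : (forall p, X p = Y p) -> X = Y.
Proof.
case: X Y => [X PX] [Y PY] /= E.
have XY : X = Y := functional_extensionality_dep E.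
by rewrite -XY in PY *; congr Vfield; exact: Prop_irrelevance.
Qed.

Program Definition vfield0 : vfield := @Vfield (fun=> 0) _.
Next Obligation.
move=> a aM; exists (fun=> 0).
  by move=> j k; apply: Ck_eq (Ck_cst k _ 0) => [|x _];
    [exact: cod_open|rewrite mxE].
by move=> p ap f; rewrite /chart_deriv derive0.
Qed.

Program Definition vfieldD (X Y : vfield) : vfield :=
  @Vfield (fun p => X p + Y p) _.
Next Obligation.
move=> X Y a aM.
have [Xi sX XE] := vfieldP X aM; have [Eta sY YE] := vfieldP Y aM.
exists (fun x => Xi x + Eta x).
  move=> j k; apply: Ck_eq (CkD (cod_open a) (sX j k) (sY j k)) => [|x _];
    [exact: cod_open|by rewrite mxE].
by move=> p ap f; rewrite chart_derivD // -XE // -YE.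
Qed.

Program Definition vfieldZ (h : smooth_fun M) (X : vfield) : vfield :=
  @Vfield (fun p => h p *: X p) _.
Next Obligation.
move=> h X a aM; have [Xi sX XE] := vfieldP X aM.
exists (fun x => h (chart_inv a x) *: Xi x).
  move=> j k.
  apply: Ck_eq (CkM (cod_open a) (smooth_funP h aM k) (sX j k)) => [|x _];
    [exact: cod_open|by rewrite mxE].
by move=> p ap f; rewrite chart_derivZ // -XE // chart_mapK.
Qed.

Lemma vfieldDA : associative vfieldD.
Proof. by move=> X Y Z; apply: vfield_ext => p /=; rewrite addrA. Qed.
Lemma vfieldDC : commutative vfieldD.
Proof. by move=> X Y; apply: vfield_ext => p /=; rewrite addrC. Qed.
Lemma vfield0D : left_id vfield0 vfieldD.
Proof. by move=> X; apply: vfield_ext => p /=; rewrite add0r. Qed.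
Lemma vfieldND : left_inverse vfield0 (vfieldZ (-1)) vfieldD.
Proof. by move=> X; apply: vfield_ext => p /=; rewrite scaleN1r addNr. Qed.
HB.instance Definition _ := GRing.isZmodule.Build vfield
  vfieldDA vfieldDC vfield0D vfieldND.

Lemma vfieldZA h k X : vfieldZ h (vfieldZ k X) = vfieldZ (h * k) X.
Proof. by apply: vfield_ext => p /=; rewrite scalerA. Qed.
Lemma vfield1Z : left_id 1 vfieldZ.
Proof. by move=> X; apply: vfield_ext => p /=; rewrite scale1r. Qed.
Lemma vfieldZDr : right_distributive vfieldZ +%R.
Proof. by move=> h X Y; apply: vfield_ext => p /=; rewrite scalerDr. Qed.
Lemma vfieldZDl X : {morph vfieldZ^~ X : h k / h + k}.
Proof. by move=> h k; apply: vfield_ext => p /=; rewrite scalerDl. Qed.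
HB.instance Definition _ := GRing.Zmodule_isLmodule.Build (smooth_fun M) vfield
  vfieldZA vfield1Z vfieldZDr vfieldZDl.

Lemma chart_deriv_smooth (a : chart R (dim M) M) (Xi : 'rV_(dim M) -> 'rV_(dim M))
    (f : smooth_fun M) : atlas M a -> smooth_map_on (chart_cod a) Xi ->
  smooth_on (chart_cod a) (fun x => 'D_(Xi x) (f \o chart_inv a) x).
Proof.
move=> aM sX k.
have H j : Ck k (chart_cod a) (fun x => Xi x ord0 j *
    'D_(delta_mx ord0 j) (f \o chart_inv a) x).
  by apply: CkM (cod_open a) (sX j k) _; exact: (smooth_funP f aM k.+1).2.
apply: Ck_eq (Ck_sum (cod_open a) H) => [|x ax]; first exact: cod_open.
by rewrite -derive_coord //; apply: (smooth_funP f aM 1).1.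
Qed.

Lemma vf_app_subproof (X : vfield) (f : smooth_fun M) :
  smooth (fun p => X p f).
Proof.
move=> a aM; have [Xi sX XE] := vfieldP X aM => k.
apply: Ck_eq (chart_deriv_smooth f aM sX k) => [|x ax]; first exact: cod_open.
by have [ay yx] := chart_invP ax; rewrite /= XE // /chart_deriv yx.
Qed.

(* The function X(f). *)
Definition vf_app (X : vfield) (f : smooth_fun M) : smooth_fun M :=
  mk_smooth (vf_app_subproof X f).

(* A smooth (0,2)-tensor field: in every chart,
   g_p(u, v) = sum_ij A_ij(p) u^i v^j with smooth coefficients A_ij; this contains
   the bilinearity of each g_p. *)
Record tensor02 := Tensor02 {
  tensor_val :> forall p, tangent p -> tangent p -> R;
  tensorP : forall a, atlas M a ->
    exists2 A : 'rV[R]_(dim M) -> 'M[R]_(dim M),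
      (forall i j, smooth_on (chart_cod a) (fun x => A x i j)) &
      forall p (u v : tangent p) xi eta, chart_dom a p ->
        u =1 chart_deriv a p xi -> v =1 chart_deriv a p eta ->
        tensor_val u v = \sum_i \sum_j A (a p) i j * xi ord0 i * eta ord0 j }.

HB.instance Definition _ := gen_eqMixin tensor02.
HB.instance Definition _ := gen_choiceMixin tensor02.

Lemma tensor_ext (g h : tensor02) :
  (forall p (u v : tangent p), g p u v = h p u v) -> g = h.
Proof.
case: g h => [g Pg] [h Ph] /= gh.
have E : g = h.
  apply: functional_extensionality_dep => p.
  by apply/funext => u; apply/funext => v.
by rewrite -E in Ph *; congr Tensor02; exact: Prop_irrelevance.
Qed.

Program Definition tensor0 : tensor02 := @Tensor02 (fun _ _ _ => 0) _.
Next Obligation.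
move=> a aM; exists (fun=> 0).
  by move=> i j k; apply: Ck_eq (Ck_cst k _ 0) => [|x _];
    [exact: cod_open|rewrite mxE].
move=> p u v xi eta _ _ _.
by rewrite big1 // => i _; rewrite big1 // => j _; rewrite mxE !mul0r.
Qed.

Program Definition tensorD (g h : tensor02) : tensor02 :=
  @Tensor02 (fun p u v => g p u v + h p u v) _.
Next Obligation.
move=> g h a aM.
have [A sA AE] := tensorP g aM; have [B sB BE] := tensorP h aM.
exists (fun x => A x + B x).
  move=> i j k; apply: Ck_eq (CkD (cod_open a) (sA i j k) (sB i j k)) => [|x _];
    [exact: cod_open|by rewrite mxE].
move=> p u v xi eta ap uE vE; rewrite (AE p u v _ _ ap uE vE).
rewrite (BE p u v _ _ ap uE vE) -big_split; apply: eq_bigr => i _ /=.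
by rewrite -big_split; apply: eq_bigr => j _ /=; rewrite mxE !mulrDl.
Qed.

Program Definition tensorZ (f : smooth_fun M) (g : tensor02) : tensor02 :=
  @Tensor02 (fun p u v => f p * g p u v) _.
Next Obligation.
move=> f g a aM; have [A sA AE] := tensorP g aM.
exists (fun x => f (chart_inv a x) *: A x).
  move=> i j k.
  apply: Ck_eq (CkM (cod_open a) (smooth_funP f aM k) (sA i j k)) => [|x _];
    [exact: cod_open|by rewrite mxE].
move=> p u v xi eta ap uE vE; rewrite (AE p u v _ _ ap uE vE) mulr_sumr.
apply: eq_bigr => i _; rewrite mulr_sumr; apply: eq_bigr => j _.
by rewrite mxE chart_mapK // !mulrA.
Qed.

Lemma tensorDA : associative tensorD.
Proof. by move=> *; apply: tensor_ext => * /=; rewrite addrA. Qed.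
Lemma tensorDC : commutative tensorD.
Proof. by move=> *; apply: tensor_ext => * /=; rewrite addrC. Qed.
Lemma tensor0D : left_id tensor0 tensorD.
Proof. by move=> *; apply: tensor_ext => * /=; rewrite add0r. Qed.
Lemma tensorND : left_inverse tensor0 (tensorZ (-1)) tensorD.
Proof. by move=> *; apply: tensor_ext => * /=; rewrite mulN1r addNr. Qed.
HB.instance Definition _ := GRing.isZmodule.Build tensor02
  tensorDA tensorDC tensor0D tensorND.

Lemma tensorZA f h g : tensorZ f (tensorZ h g) = tensorZ (f * h) g.
Proof. by apply: tensor_ext => * /=; rewrite mulrA. Qed.
Lemma tensor1Z : left_id 1 tensorZ.
Proof. by move=> *; apply: tensor_ext => * /=; rewrite mul1r. Qed.
Lemma tensorZDr : right_distributive tensorZ +%R.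
Proof. by move=> *; apply: tensor_ext => * /=; rewrite mulrDr. Qed.
Lemma tensorZDl g : {morph tensorZ^~ g : f h / f + h}.
Proof. by move=> *; apply: tensor_ext => * /=; rewrite mulrDl. Qed.
HB.instance Definition _ := GRing.Zmodule_isLmodule.Build (smooth_fun M) tensor02
  tensorZA tensor1Z tensorZDr tensorZDl.

(* df (x) dh *)
Program Definition dtens (f h : smooth_fun M) : tensor02 :=
  @Tensor02 (fun p u v => u f * v h) _.
Next Obligation.
move=> f h a aM.
pose D (f : smooth_fun M) (x : 'rV[R]_(dim M)) i :=
  'D_(delta_mx ord0 i) (f \o chart_inv a) x.
exists (fun x => \matrix_(i, j) (D f x i * D h x j)).
  move=> i j k.
  have := CkM (cod_open a) ((smooth_funP f aM k.+1).2 (delta_mx ord0 i))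
    ((smooth_funP h aM k.+1).2 (delta_mx ord0 j)).
  by apply: Ck_eq => [|x _]; [exact: cod_open|rewrite mxE].
move=> p u v xi eta ap uE vE.
rewrite uE vE /chart_deriv (derive_coord _ (chart_diff f aM ap)).
rewrite (derive_coord _ (chart_diff h aM ap)) mulr_suml.
apply: eq_bigr => i _; rewrite mulr_sumr; apply: eq_bigr => j _.
by rewrite mxE /D mulrACA mulrC mulrA.
Qed.

Lemma tensor_app_subproof (g : tensor02) (X Y : vfield) :
  smooth (fun p => g p (X p) (Y p)).
Proof.
move=> a aM; have [A sA AE] := tensorP g aM.
have [Xi sX XE] := vfieldP X aM; have [Eta sY YE] := vfieldP Y aM => k.
have H i : Ck k (chart_cod a)
    (fun x => \sum_j A x i j * Xi x ord0 i * Eta x ord0 j).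
  apply: Ck_sum (cod_open a) _ => j; apply: CkM (cod_open a) _ (sY j k).
  exact: CkM (cod_open a) (sA i j k) (sX i k).
apply: Ck_eq (Ck_sum (cod_open a) H) => [|x ax]; first exact: cod_open.
have [ay yx] := chart_invP ax; rewrite /= (AE _ _ _ _ _ ay (XE _ ay) (YE _ ay)).
by rewrite yx.
Qed.

(* The function g(X, Y). *)
Definition tensor_app (g : tensor02) (X Y : vfield) : smooth_fun M :=
  mk_smooth (tensor_app_subproof g X Y).

End Tangent.

Record smooth_map (R : realType) (M N : manifold R) := SmoothMap {
  smooth_map_val :> M -> N;
  smooth_map_continuous : continuous smooth_map_val;
  smooth_mapP : forall a b, atlas M a -> atlas N b ->
    smooth_map_on (a @` (chart_dom a `&` smooth_map_val @^-1` chart_dom b))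
                  (b \o smooth_map_val \o chart_inv a) }.

Section SmoothMap.
Context {R : realType}.

Section Push.
Variables (M N : manifold R) (phi : smooth_map M N).
Implicit Types (a : chart R (dim M) M) (b : chart R (dim N) N).

Let dom2 a b := chart_dom a `&` phi @^-1` chart_dom b.

Lemma smap_dom_open a b : open (a @` dom2 a b).
Proof.
apply: chart_image_open; apply: open_comp; last exact: chart_dom_open.
by move=> p _; exact: smooth_map_continuous.
Qed.

Lemma smap_factor a b (f : N -> R) x : (a @` dom2 a b) x ->
  ((f \o chart_inv b) \o (b \o phi \o chart_inv a)) x =
  ((f \o phi) \o chart_inv a) x.
Proof. by move=> [p [ap bp] <-]; rewrite /= chart_mapK // chart_mapK. Qed.

Lemma pullback_subproof (f : smooth_fun N) : smooth (f \o phi).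
Proof.
move=> a aM k; apply: Ck_local => _ [p ap <-].
have [b bN bp] := atlas_cover (phi p).
exists (a @` dom2 a b); split; [exact: smap_dom_open|by exists p|].
apply: Ck_eq (@smap_factor a b f) _; first exact: smap_dom_open.
apply: Ck_comp (smooth_funP f bN k) => [||j]; [exact: smap_dom_open| |].
  by move=> _ [q [aq bq] <-]; rewrite /= chart_mapK //; exact: chart_codP.
exact: (smooth_mapP phi aM bN j k).
Qed.

Definition pullback (f : smooth_fun N) : smooth_fun M :=
  mk_smooth (pullback_subproof f).

Lemma smap_diff a b p : atlas M a -> atlas N b -> chart_dom a p ->
  chart_dom b (phi p) -> differentiable (b \o phi \o chart_inv a) (a p).
Proof.
move=> aM bN ap bp; apply: differentiable_row => j.
by have [+ _] := smooth_mapP phi aM bN j 1; apply; exists p.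
Qed.

Lemma smap_deriv a b p xi (f : smooth_fun N) :
  atlas M a -> atlas N b -> chart_dom a p -> chart_dom b (phi p) ->
  'D_xi ((f \o phi) \o chart_inv a) (a p) =
  chart_deriv b (phi p) ('D_xi (b \o phi \o chart_inv a) (a p)) f.
Proof.
move=> aM bN ap bp.
have E : (b \o phi \o chart_inv a) (a p) = b (phi p) by rewrite /= chart_mapK.
rewrite /chart_deriv -E -derive_comp; [|exact: smap_diff|]; last first.
  by rewrite E; exact: chart_diff.
apply: near_eq_derive; apply: near_open (@smap_dom_open a b) _ _; first by exists p.
by move=> x /(@smap_factor a b f).
Qed.

Program Definition tangent_map (p : M) (v : tangent p) : tangent (phi p) :=
  @Tangent _ _ (phi p) (fun f => v (pullback f)) _.
Next Obligation.
move=> p v b bN bp; have [a aM ap] := atlas_cover p.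
have [xi vE] := tangentP v aM ap.
exists ('D_xi (b \o phi \o chart_inv a) (a p)) => f.
by rewrite vE -smap_deriv.
Qed.

End Push.

Program Definition smooth_id (M : manifold R) : smooth_map M M :=
  @SmoothMap _ M M id _ _.
Next Obligation. by move=> M p; exact: cvg_id. Qed.
Next Obligation. by move=> M a b; exact: atlas_smooth. Qed.

Lemma chart_tangent (M : manifold R) (a : chart R (dim M) M) p xi :
  atlas M a -> chart_dom a p ->
  exists v : tangent p, v =1 chart_deriv a p xi.
Proof.
move=> aM ap.
have H b : atlas M b -> chart_dom b p ->
    exists eta, chart_deriv a p xi =1 chart_deriv b p eta.
  move=> bM bp; exists ('D_xi (b \o smooth_id M \o chart_inv a) (a p)) => f.
  exact: (@smap_deriv M M (smooth_id M) a b p xi f).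
by exists (Tangent H).
Qed.

Section TensorPull.
Variables (M N : manifold R) (phi : smooth_map M N).

Lemma tensor_lin (g : tensor02 N) q n (u v : 'I_n -> tangent q) (x y : 'I_n -> R)
    (u' v' : tangent q) :
  (forall f, u' f = \sum_i x i * u i f) -> (forall f, v' f = \sum_i y i * v i f) ->
  g q u' v' = \sum_i \sum_j g q (u i) (v j) * x i * y j.
Proof.
move=> uE vE; have [b bN bq] := atlas_cover q.
have [A _ AE] := tensorP g bN.
pose cu i := projT1 (cid (tangentP (u i) bN bq)).
pose cv i := projT1 (cid (tangentP (v i) bN bq)).
have cuE i : u i =1 chart_deriv b q (cu i) by exact: (projT2 (cid (tangentP (u i) bN bq))).
have cvE i : v i =1 chart_deriv b q (cv i) by exact: (projT2 (cid (tangentP (v i) bN bq))).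
have lin (c : 'I_n -> 'rV[R]_(dim N)) (z : 'I_n -> R) f :
    chart_deriv b q (\sum_i z i *: c i) f = \sum_i z i * chart_deriv b q (c i) f.
  rewrite /chart_deriv deriveE; last exact: chart_diff.
  rewrite raddf_sum; apply: eq_bigr => i _; rewrite [LHS]linearZ /=.
  by rewrite -deriveE //; exact: chart_diff.
have u'E : u' =1 chart_deriv b q (\sum_i x i *: cu i).
  by move=> f; rewrite uE lin; apply: eq_bigr => i _; rewrite cuE.
have v'E : v' =1 chart_deriv b q (\sum_i y i *: cv i).
  by move=> f; rewrite vE lin; apply: eq_bigr => i _; rewrite cvE.
rewrite (AE _ _ _ _ _ bq u'E v'E).
under [RHS]eq_bigr => i _ do under eq_bigr => j _ do
  rewrite (AE _ _ _ _ _ bq (cuE i) (cvE j)).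
transitivity (\sum_(j < n) \sum_(i < n) \sum_k \sum_l
   A (b q) k l * (x i * cu i ord0 k) * (y j * cv j ord0 l)).
  under eq_bigr => k _ do under eq_bigr => l _ do rewrite !summxE mulr_sumr.
  under eq_bigr => k _ do under eq_bigr => l _ do
    under eq_bigr => j _ do rewrite mulr_sumr mulr_suml.
  under eq_bigr => k _ do rewrite exchange_big /=.
  rewrite exchange_big /=; apply: eq_bigr => j _.
  under eq_bigr => k _ do rewrite exchange_big /=.
  rewrite exchange_big /=; apply: eq_bigr => i _.
  by apply: eq_bigr => k _; apply: eq_bigr => l _; rewrite !mxE.
rewrite exchange_big /=.
apply: eq_bigr => i _; apply: eq_bigr => j _.
rewrite !mulr_suml; apply: eq_bigr => k _.
rewrite !mulr_suml; apply: eq_bigr => l _.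
by rewrite -!mulrA; congr (_ * _); rewrite mulrCA; congr (_ * _);
   rewrite [RHS]mulrCA; congr (_ * _); rewrite mulrC.
Qed.

Program Definition tensor_pullback (g : tensor02 N) : tensor02 M :=
  @Tensor02 _ M (fun p u v => g (phi p) (tangent_map phi u) (tangent_map phi v)) _.
Next Obligation.
move=> g a aM.
pose e (j : 'I_(dim M)) : 'rV[R]_(dim M) := delta_mx ord0 j.
have bas p : {w : 'I_(dim M) -> tangent p |
    chart_dom a p -> forall j, w j =1 chart_deriv a p (e j)}.
  have [ap|nap] := pselect (chart_dom a p); last by exists (fun=> 0).
  exists (fun j => projT1 (cid (chart_tangent (e j) aM ap))) => _ j.
  exact: (projT2 (cid (chart_tangent (e j) aM ap))).
pose w p := projT1 (bas p); have wE p := projT2 (bas p).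
pose A x := \matrix_(i, j) g (phi (chart_inv a x))
  (tangent_map phi (w _ i)) (tangent_map phi (w (chart_inv a x) j)).
exists A.
  move=> i j k; apply: Ck_local => _ [p ap <-].
  have [b bN bp] := atlas_cover (phi p).
  have [B sB BE] := tensorP g bN.
  pose F := b \o phi \o chart_inv a.
  pose V := a @` (chart_dom a `&` phi @^-1` chart_dom b).
  have oV : open V by exact: smap_dom_open.
  exists V; split => //; first by exists p.
  have CF l m k' : Ck k' V (fun x => 'D_(e l) (fun x => F x ord0 m) x).
    exact: (smooth_mapP phi aM bN m k'.+1).2.
  have CB l m : Ck k V (fun x => B (F x) l m).
    apply: (Ck_comp oV _ _ (sB l m k)) => [|r]; last exact: smooth_mapP.
    by move=> _ [q [aq bq] <-]; rewrite /F /= chart_mapK //; exact: chart_codP.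
  have C l : Ck k V (fun x => \sum_m B (F x) l m *
      'D_(e i) (fun x => F x ord0 l) x * 'D_(e j) (fun x => F x ord0 m) x).
    apply: (Ck_sum oV) => m.
    exact: (CkM oV (CkM oV (CB l m) (CF i l k)) (CF j m k)).
  apply: (Ck_eq oV _ (Ck_sum oV C)) => _ [q [aq bq] <-].
  rewrite mxE chart_mapK //.
  have pw l : tangent_map phi (w q l) =1
      chart_deriv b (phi q) ('D_(e l) F (a q)).
    by move=> f; rewrite -smap_deriv //; exact: wE.
  rewrite (BE _ _ _ _ _ bq (pw i) (pw j)).
  have Fq : F (a q) = b (phi q) by rewrite /F /= chart_mapK.
  have dF : differentiable F (a q) by exact: smap_diff.
  by apply: eq_bigr => l _; apply: eq_bigr => m _; rewrite Fq !derive_row.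
move=> p u v xi eta ap uE vE.
have lin (z : tangent p) ze f : z =1 chart_deriv a p ze ->
    tangent_map phi z f = \sum_i ze ord0 i * tangent_map phi (w p i) f.
  move=> zE; rewrite /= zE /chart_deriv derive_coord; last exact: chart_diff.
  by apply: eq_bigr => i _; congr (_ * _); rewrite -[LHS]/(chart_deriv a p (e i) (pullback phi f)) -wE.
rewrite (@tensor_lin g (phi p) _ (fun i => tangent_map phi (w p i))
  (fun i => tangent_map phi (w p i)) (xi ord0) (eta ord0)).
- by apply: eq_bigr => i _; apply: eq_bigr => j _; rewrite mxE chart_mapK.
- by move=> f; exact: lin.
- by move=> f; exact: lin.
Qed.

(* X and Y are phi-related. *)
Definition related (X : vfield M) (Y : vfield N) : Prop :=
  forall p, tangent_map phi (X p) = Y (phi p).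

End TensorPull.
End SmoothMap.

Section ProdTop.
Context {R : realType}.

Lemma continuous_row_mx (T : topologicalType) n1 n2 (F : T -> 'rV[R]_n1)
    (G : T -> 'rV[R]_n2) x : {for x, continuous F} -> {for x, continuous G} ->
  {for x, continuous (fun y => row_mx (F y) (G y))}.
Proof.
move=> cF cG A [P nP PA].
have : \forall y \near x, forall j, P ord0 j (row_mx (F y) (G y) ord0 j).
  apply: (filter_forall (F := nbhs x)
    (f := fun j y => P ord0 j (row_mx (F y) (G y) ord0 j))) => j.
  have := nP ord0 j; case: (split_ordP j) => l ->.
    rewrite row_mxEl => nPl.
    have H : \forall y \near x, P ord0 (lshift n2 l) (F y ord0 l) :=
      @continuous_comp _ _ _ F (fun u : 'rV[R]_n1 => u ord0 l) x cF
      (@coord_continuous _ _ _ _ _ _) _ nPl.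
    by apply: filterS H => y /=; rewrite row_mxEl.
  rewrite row_mxEr => nPl.
  have H : \forall y \near x, P ord0 (rshift n1 l) (G y ord0 l) :=
    @continuous_comp _ _ _ G (fun u : 'rV[R]_n2 => u ord0 l) x cG
    (@coord_continuous _ _ _ _ _ _) _ nPl.
  by apply: filterS H => y /=; rewrite row_mxEr.
by apply: filterS => y Py; apply: PA => i j; rewrite (ord1 i); exact: Py.
Qed.

Lemma open_prod (S T : topologicalType) (A : set S) (B : set T) :
  open A -> open B -> open (A `*` B).
Proof.
move=> oA oB; rewrite openE => -[x y] [/= Ax By].
by exists (A, B) => //; split; exact: open_nbhs_nbhs.
Qed.

Lemma prod_hausdorff (S T : topologicalType) :
  hausdorff_space S -> hausdorff_space T -> hausdorff_space (S * T)%type.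
Proof.
move=> hS hT [p1 p2] [q1 q2] pq; congr (_, _).
  apply: hS => A B nA nB.
  have nA' : nbhs (p1, p2) (A `*` [set: T]).
    by exists (A, setT) => //; split=> //; exact: filterT.
  have nB' : nbhs (q1, q2) (B `*` [set: T]).
    by exists (B, setT) => //; split=> //; exact: filterT.
  by have [[x y] [[/= Ax _] [/= Bx _]]] := pq _ _ nA' nB'; exists x.
apply: hT => A B nA nB.
have nA' : nbhs (p1, p2) ([set: S] `*` A).
  by exists (setT, A) => //; split=> //; exact: filterT.
have nB' : nbhs (q1, q2) ([set: S] `*` B).
  by exists (setT, B) => //; split=> //; exact: filterT.
by have [[x y] [[/= _ Ax] [/= _ Bx]]] := pq _ _ nA' nB'; exists y.
Qed.

Lemma prod_second_countable (S T : topologicalType) :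
  @second_countable S -> @second_countable T ->
  @second_countable (S * T)%type.
Proof.
move=> [B cB [oB bB]] [C cC [oC bC]].
exists [set D.1 `*` D.2 | D in B `*` C].
  apply: sub_countable (countableX cB cC); exact: card_image_le.
split.
  move=> _ [[D E] [/= BD CE] <-]; exact: open_prod (oB _ BD) (oC _ CE).
move=> [x y] A [[U V] /= [nU nV] UVA].
have [D [BD Dx] DU] := bB x _ nU; have [E [CE Ey] EV] := bC y _ nV.
exists (D `*` E); first by split=> //; exists (D, E).
by move=> [u v] [/= Du Ev]; apply: UVA; split; [exact: DU|exact: EV].
Qed.

End ProdTop.

Section ProdChart.
Context {R : realType} {n1 n2 : nat} {M1 M2 : topologicalType}.
Variables (a1 : chart R n1 M1) (a2 : chart R n2 M2).

Lemma prod_codE :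
  (fun p : M1 * M2 => row_mx (a1 p.1) (a2 p.2)) @`
    (chart_dom a1 `*` chart_dom a2) =
  (lsubmx @^-1` chart_cod a1) `&` (rsubmx @^-1` chart_cod a2).
Proof.
apply/seteqP; split=> [_ [[p1 p2] [/= d1 d2] <-]|x [/= [p1 d1 e1] [p2 d2 e2]]].
  by split; rewrite /= ?row_mxKl ?row_mxKr; exact: chart_codP.
by exists (p1, p2) => //=; rewrite e1 e2 hsubmxK.
Qed.

Program Definition prod_chart : chart R (n1 + n2) (M1 * M2)%type :=
  @Chart R (n1 + n2) (M1 * M2)%type
    (chart_dom a1 `*` chart_dom a2)
    (fun p => row_mx (a1 p.1) (a2 p.2))
    (fun x => (chart_inv a1 (lsubmx x), chart_inv a2 (rsubmx x)))
    _ _ _ _ _.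
Next Obligation. by apply: open_prod; exact: chart_dom_open. Qed.
Next Obligation.
rewrite prod_codE; apply: openI; apply: open_comp; try exact: chart_cod_open.
  by move=> x _; exact: continuous_lsubmx.
by move=> x _; exact: continuous_rsubmx.
Qed.
Next Obligation.
by move=> [p1 p2] [/= d1 d2]; rewrite row_mxKl row_mxKr !chart_mapK.
Qed.
Next Obligation.
move=> [p1 p2] [/= d1 d2]; apply: continuous_row_mx.
  apply: (@continuous_comp _ _ _ fst (chart_map a1)); first exact: cvg_fst.
  exact: chart_map_continuous.
apply: (@continuous_comp _ _ _ snd (chart_map a2)); first exact: cvg_snd.
exact: chart_map_continuous.
Qed.
Next Obligation.
move=> x; rewrite prod_codE => -[x1 x2].
have H1 : {for x, continuous (chart_inv a1 \o lsubmx)}.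
  apply: continuous_comp; first exact: continuous_lsubmx.
  exact: chart_inv_continuous x1.
have H2 : {for x, continuous (chart_inv a2 \o rsubmx)}.
  apply: continuous_comp; first exact: continuous_rsubmx.
  exact: chart_inv_continuous x2.
exact: cvg_pair H1 H2.
Qed.

End ProdChart.

Section ProdManifold.
Context {R : realType}.

Lemma smooth_row_mx m n1 n2 (V : set 'rV[R]_m) (F : 'rV[R]_m -> 'rV[R]_n1)
    (G : 'rV[R]_m -> 'rV[R]_n2) : open V ->
  smooth_map_on V F -> smooth_map_on V G ->
  smooth_map_on V (fun x => row_mx (F x) (G x)).
Proof.
move=> oV sF sG j k; case: (split_ordP j) => l ->.
  by apply: Ck_eq oV _ (sF l k) => x _; rewrite row_mxEl.
by apply: Ck_eq oV _ (sG l k) => x _; rewrite row_mxEr.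
Qed.

Lemma smooth_lsubmx m n1 n2 (U : set 'rV[R]_n1) (V : set 'rV[R]_(n1 + n2))
    (F : 'rV[R]_n1 -> 'rV[R]_m) : open V -> (forall x, V x -> U (lsubmx x)) ->
  smooth_map_on U F -> smooth_map_on V (F \o lsubmx).
Proof.
move=> oV VU sF j k; apply: (Ck_comp oV VU _ (sF j k)) => i.
by apply: Ck_eq oV _ (Ck_coord k V (lshift n2 i)) => x _; rewrite mxE.
Qed.

Lemma smooth_rsubmx m n1 n2 (U : set 'rV[R]_n2) (V : set 'rV[R]_(n1 + n2))
    (F : 'rV[R]_n2 -> 'rV[R]_m) : open V -> (forall x, V x -> U (rsubmx x)) ->
  smooth_map_on U F -> smooth_map_on V (F \o rsubmx).
Proof.
move=> oV VU sF j k; apply: (Ck_comp oV VU _ (sF j k)) => i.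
by apply: Ck_eq oV _ (Ck_coord k V (rshift n1 i)) => x _; rewrite mxE.
Qed.

Variables M1 M2 : manifold R.

Definition prod_atlas : set (chart R (dim M1 + dim M2) (M1 * M2)%type) :=
  [set a | exists a1 a2, [/\ atlas M1 a1, atlas M2 a2 & a = prod_chart a1 a2]].

Program Definition prod_manifold : manifold R :=
  @Manifold R (M1 * M2)%type (dim M1 + dim M2) prod_atlas _ _ _ _ _.
Next Obligation.
have [p1 _] := manifold_nonempty M1; have [p2 _] := manifold_nonempty M2.
by exists (p1, p2).
Qed.
Next Obligation. by apply: prod_hausdorff; exact: manifold_hausdorff. Qed.
Next Obligation.
by apply: prod_second_countable; exact: manifold_second_countable.
Qed.
Next Obligation.
move=> [p1 p2]; have [a1 A1 d1] := atlas_cover p1.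
have [a2 A2 d2] := atlas_cover p2.
by exists (prod_chart a1 a2); [exists a1, a2|split].
Qed.
Next Obligation.
move=> a b [a1 [a2 [A1 A2 ->]]] [b1 [b2 [B1 B2 ->]]].
set V := _ @` _.
have oV : open V by apply: chart_image_open; exact: chart_dom_open.
apply: smooth_row_mx => //.
  apply: (smooth_lsubmx oV _ (atlas_smooth A1 B1)).
  move=> _ [[p1 p2] [[/= d1 d2] [/= e1 e2]] <-]; rewrite row_mxKl.
  by exists p1.
apply: (smooth_rsubmx oV _ (atlas_smooth A2 B2)).
move=> _ [[p1 p2] [[/= d1 d2] [/= e1 e2]] <-]; rewrite row_mxKr.
by exists p2.
Qed.

Program Definition proj1_map : smooth_map prod_manifold M1 :=
  @SmoothMap R prod_manifold M1 (fun p => p.1) _ _.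
Next Obligation. by move=> p; exact: cvg_fst. Qed.
Next Obligation.
move=> _ b [a1 [a2 [A1 A2 ->]]] bM.
apply: (smooth_lsubmx _ _ (atlas_smooth A1 bM)).
  apply: chart_image_open; apply: open_comp; last exact: chart_dom_open.
  by move=> p _; exact: cvg_fst.
by move=> _ [[p1 p2] [[/= d1 d2] e1] <-]; rewrite /= row_mxKl; exists p1.
Qed.

Program Definition proj2_map : smooth_map prod_manifold M2 :=
  @SmoothMap R prod_manifold M2 (fun p => p.2) _ _.
Next Obligation. by move=> p; exact: cvg_snd. Qed.
Next Obligation.
move=> _ b [a1 [a2 [A1 A2 ->]]] bM.
apply: (smooth_rsubmx _ _ (atlas_smooth A2 bM)).
  apply: chart_image_open; apply: open_comp; last exact: chart_dom_open.
  by move=> p _; exact: cvg_snd.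
by move=> _ [[p1 p2] [[/= d1 d2] e1] <-]; rewrite /= row_mxKr; exists p2.
Qed.

Program Definition slice1 (p2 : M2) : smooth_map M1 prod_manifold :=
  @SmoothMap R M1 prod_manifold (fun p => (p, p2)) _ _.
Next Obligation. by move=> p2 p; apply: cvg_pair => //=; exact: cvg_cst. Qed.
Next Obligation.
move=> p2 a _ aM [b1 [b2 [B1 B2 ->]]].
apply: smooth_row_mx.
- apply: chart_image_open; apply: open_comp; last first.
    by apply: open_prod; exact: chart_dom_open.
  by move=> p _; apply: cvg_pair => //=; exact: cvg_cst.
- move=> j k; apply: Ck_sub (atlas_smooth aM B1 j k).
  by move=> _ [p [ap [/= e1 e2]] <-]; exists p.
- by move=> j k /=; exact: Ck_cst.
Qed.

Program Definition slice2 (p1 : M1) : smooth_map M2 prod_manifold :=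
  @SmoothMap R M2 prod_manifold (fun p => (p1, p)) _ _.
Next Obligation. by move=> p1 p; apply: cvg_pair => //=; exact: cvg_cst. Qed.
Next Obligation.
move=> p1 a _ aM [b1 [b2 [B1 B2 ->]]].
apply: smooth_row_mx.
- apply: chart_image_open; apply: open_comp; last first.
    by apply: open_prod; exact: chart_dom_open.
  by move=> p _; apply: cvg_pair => //=; exact: cvg_cst.
- by move=> j k /=; exact: Ck_cst.
- move=> j k; apply: Ck_sub (atlas_smooth aM B2 j k).
  by move=> _ [p [ap [/= e1 e2]] <-]; exists p.
Qed.

Lemma derive_along (V W : normedModType R) (f : V -> R) (g : W -> R) x y v w :
  (forall h : R, f (h *: v + x) = g (h *: w + y)) -> 'D_v f x = 'D_w g y.
Proof.
move=> fg; have := fg 0; rewrite !scale0r !add0r => fgx; rewrite /derive.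
have -> // : (fun h : R => h^-1 *: ((f \o shift x) (h *: v) - f x)) =
  (fun h => h^-1 *: ((g \o shift y) (h *: w) - g y)).
by apply/funext => h /=; rewrite fg fgx.
Qed.

Definition is_hlift (X1 : vfield M1) (X : vfield prod_manifold) : Prop :=
  related proj1_map X X1 /\ related proj2_map X 0.
Definition is_vlift (X2 : vfield M2) (X : vfield prod_manifold) : Prop :=
  related proj1_map X 0 /\ related proj2_map X X2.

Lemma is_hlift_exists (X1 : vfield M1) : exists X, is_hlift X1 X.
Proof.
pose V (p : prod_manifold) : tangent p :=
  match p with (p1, p2) => tangent_map (slice1 p2) (X1 p1) end.
have PV a : atlas prod_manifold a ->
  exists2 Xi : 'rV[R]_(dim prod_manifold) -> 'rV[R]_(dim prod_manifold),
    smooth_map_on (chart_cod a) Xi &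
    forall p, chart_dom a p -> V p =1 chart_deriv a p (Xi (a p)).
  move=> aP; have [a1 [a2 [A1 A2 aE]]] := aP.
  have [Xi sX XE] := vfieldP X1 A1.
  exists (fun x => row_mx (Xi (lsubmx x)) 0).
    apply: smooth_row_mx; first exact: chart_cod_open.
      apply: (smooth_lsubmx _ _ sX); first exact: chart_cod_open.
      rewrite aE => _ [[p1 p2] [/= d1 d2] <-].
      by rewrite row_mxKl; exact: chart_codP.
    move=> j k; apply: Ck_eq (Ck_cst k _ 0) => [|x _]; first exact: chart_cod_open.
    by rewrite mxE.
  move=> [p1 p2] ap f; have := ap; rewrite aE => -[/= d1 d2].
  rewrite XE // /chart_deriv /= row_mxKl; apply: derive_along => h /=.
  rewrite scale_row_mx add_row_mx scaler0 add0r.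
  by rewrite !row_mxKl !row_mxKr chart_mapK.
exists (Vfield PV); split=> -[p1 p2]; apply: tangent_ext => f /=.
  by congr (X1 p1 _); exact: smooth_fun_ext.
have [a1 A1 d1] := atlas_cover p1.
have [Xi _ ->] := vfieldP X1 A1 => //.
rewrite /chart_deriv (_ : _ \o _ = cst (f p2)); last exact/funext.
exact: derive_cst.
Qed.

Lemma is_vlift_exists (X2 : vfield M2) : exists X, is_vlift X2 X.
Proof.
pose V (p : prod_manifold) : tangent p :=
  match p with (p1, p2) => tangent_map (slice2 p1) (X2 p2) end.
have PV a : atlas prod_manifold a ->
  exists2 Xi : 'rV[R]_(dim prod_manifold) -> 'rV[R]_(dim prod_manifold),
    smooth_map_on (chart_cod a) Xi &
    forall p, chart_dom a p -> V p =1 chart_deriv a p (Xi (a p)).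
  move=> aP; have [a1 [a2 [A1 A2 aE]]] := aP.
  have [Xi sX XE] := vfieldP X2 A2.
  exists (fun x => row_mx 0 (Xi (rsubmx x))).
    apply: smooth_row_mx; first exact: chart_cod_open.
      move=> j k; apply: Ck_eq (Ck_cst k _ 0) => [|x _]; first exact: chart_cod_open.
      by rewrite mxE.
    apply: (smooth_rsubmx _ _ sX); first exact: chart_cod_open.
    rewrite aE => _ [[p1 p2] [/= d1 d2] <-].
    by rewrite row_mxKr; exact: chart_codP.
  move=> [p1 p2] ap f; have := ap; rewrite aE => -[/= d1 d2].
  rewrite XE // /chart_deriv /= row_mxKr; apply: derive_along => h /=.
  rewrite scale_row_mx add_row_mx scaler0 add0r.
  by rewrite !row_mxKl !row_mxKr chart_mapK.
exists (Vfield PV); split=> -[p1 p2]; apply: tangent_ext => f /=; last first.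
  by congr (X2 p2 _); exact: smooth_fun_ext.
have [a2 A2 d2] := atlas_cover p2.
have [Xi _ ->] := vfieldP X2 A2 => //.
rewrite /chart_deriv (_ : _ \o _ = cst (f p1)); last exact/funext.
exact: derive_cst.
Qed.

(* The lifts are unique, a tangent vector of the product being determined by its
   images under the two projections; [hliftP] and [vliftP] are their existence. *)
Definition hlift (X1 : vfield M1) : vfield prod_manifold :=
  xget 0 [set X | is_hlift X1 X].
Definition vlift (X2 : vfield M2) : vfield prod_manifold :=
  xget 0 [set X | is_vlift X2 X].

Lemma hliftP X1 : is_hlift X1 (hlift X1).
Proof. exact: xgetPex (is_hlift_exists X1). Qed.
Lemma vliftP X2 : is_vlift X2 (vlift X2).
Proof. exact: xgetPex (is_vlift_exists X2). Qed.

End ProdManifold.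

Section Statistical.
Context {R : realType} {M : manifold R}.
Implicit Types (X Y Z : vfield M) (f : smooth_fun M) (g : tensor02 M).

Definition symmetric_tensor g : Prop :=
  forall p (u v : tangent p), g p u v = g p v u.

Definition riemannian g : Prop :=
  symmetric_tensor g /\ (forall p (u : tangent p), u != 0 -> 0 < g p u u).

Definition pseudo_riemannian g : Prop :=
  symmetric_tensor g /\
  (forall p (u : tangent p), (forall v, g p u v = 0) -> u = 0).

Definition is_grad g f W : Prop := forall p (v : tangent p), g p (W p) v = v f.

(* For a nondegenerate [g] the gradient exists and is unique. *)
Definition grad g f : vfield M := xget 0 [set W : vfield M | is_grad g f W].

(* [cov_leibniz] applied to constant [f] gives R-homogeneity in the second
   argument. *)
Record connection := Connection {
  cov :> vfield M -> vfield M -> vfield M;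
  cov_linear_l : forall f X Y Z, cov (f *: X + Y) Z = f *: cov X Z + cov Y Z;
  cov_additive_r : forall X Y Z, cov X (Y + Z) = cov X Y + cov X Z;
  cov_leibniz : forall f X Y, cov X (f *: Y) = vf_app X f *: Y + f *: cov X Y }.

(* [X, Y] as a derivation of C^oo(M). *)
Definition lie_bracket X Y f : smooth_fun M :=
  vf_app X (vf_app Y f) - vf_app Y (vf_app X f).

Definition torsion_free (nab : connection) : Prop :=
  forall X Y f, vf_app (nab X Y - nab Y X) f = lie_bracket X Y f.

(* (nabla g)(X, Y, Z) *)
Definition cov_metric (nab : connection) g X Y Z : smooth_fun M :=
  vf_app X (tensor_app g Y Z) - tensor_app g (nab X Y) Z
    - tensor_app g Y (nab X Z).

Definition statistical_manifold (nab : connection) g : Prop :=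
  [/\ pseudo_riemannian g, torsion_free nab &
      forall X Y Z, cov_metric nab g X Y Z = cov_metric nab g Y X Z].

Lemma ln_fun_subproof f : (forall p, 0 < f p) -> smooth (fun p => ln (f p)).
Proof.
move=> f0 a aM k.
by apply: (Ck_ln (cod_open a) _ (smooth_funP f aM k)) => x _; exact: f0.
Qed.

Definition ln_fun f (f_gt0 : forall p, 0 < f p) : smooth_fun M :=
  mk_smooth (ln_fun_subproof f_gt0).

(* B_f(X, Y) = c f {X(Y(f)) - (nabla_X Y)(f)} + c X(f) Y(f) - g(X, Y) *)
Definition warp_form (c : R) g (nab : connection) f X Y : smooth_fun M :=
  c *: f * (vf_app X (vf_app Y f) - vf_app (nab X Y) f)
    + c *: (vf_app X f * vf_app Y f) - tensor_app g X Y.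

End Statistical.
Arguments connection {R} M.

Section Warped.
Context {R : realType} {M1 M2 : manifold R}.

(* f^h and f^v *)
Definition hfun (f : smooth_fun M1) : smooth_fun (prod_manifold M1 M2) :=
  pullback (proj1_map M1 M2) f.
Definition vfun (f : smooth_fun M2) : smooth_fun (prod_manifold M1 M2) :=
  pullback (proj2_map M1 M2) f.

(* (f2^v)^2 pi1^* g1 + (f1^h)^2 pi2^* g2
     + c f1^h f2^v (df1^h (x) df2^v + df2^v (x) df1^h) *)
Definition warped_metric (c : R) (g1 : tensor02 M1) (g2 : tensor02 M2)
    (f1 : smooth_fun M1) (f2 : smooth_fun M2) : tensor02 (prod_manifold M1 M2) :=
  vfun f2 ^+ 2 *: tensor_pullback (proj1_map M1 M2) g1
  + hfun f1 ^+ 2 *: tensor_pullback (proj2_map M1 M2) g2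
  + (c *: (hfun f1 * vfun f2)) *:
      (dtens (hfun f1) (vfun f2) + dtens (vfun f2) (hfun f1)).

(* The formulas on lifts that characterize the induced connection [nab]. *)
Definition induced_connection (c : R) (g1 : tensor02 M1) (g2 : tensor02 M2)
    (f1 : smooth_fun M1) (f2 : smooth_fun M2)
    (f1_gt0 : forall p, 0 < f1 p) (f2_gt0 : forall p, 0 < f2 p)
    (nab1 : connection M1) (nab2 : connection M2)
    (nab : connection (prod_manifold M1 M2)) : Prop :=
  let G := warped_metric c g1 g2 f1 f2 in
  let mixed (X1 : vfield M1) (Y2 : vfield M2) :=
    - (c *: (hfun (vf_app X1 f1) * vfun (vf_app Y2 f2))) *:
        (vfun f2 *: grad G (hfun f1) + hfun f1 *: grad G (vfun f2))
    + vfun (vf_app Y2 (ln_fun f2_gt0)) *: hlift M2 X1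
    + hfun (vf_app X1 (ln_fun f1_gt0)) *: vlift M1 Y2 in
  [/\ forall X1 Y1 : vfield M1, nab (hlift M2 X1) (hlift M2 Y1) =
        hlift M2 (nab1 X1 Y1)
        + (vfun f2 * hfun (warp_form c g1 nab1 f1 X1 Y1)) *: grad G (vfun f2),
      forall X2 Y2 : vfield M2, nab (vlift M1 X2) (vlift M1 Y2) =
        vlift M1 (nab2 X2 Y2)
        + (hfun f1 * vfun (warp_form c g2 nab2 f2 X2 Y2)) *: grad G (hfun f1),
      forall (X1 : vfield M1) (Y2 : vfield M2),
        nab (hlift M2 X1) (vlift M1 Y2) = mixed X1 Y2 &
      forall (X1 : vfield M1) (Y2 : vfield M2),
        nab (vlift M1 Y2) (hlift M2 X1) = mixed X1 Y2].

End Warped.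

(* Main.v *)
(** All defects involved, the torsion and the failure of symmetry of the covariant
    derivative of a metric, are C^oo-multilinear.  On the product every vector field
    becomes a C^oo-combination of lifts once multiplied by a suitable bump function,
    so it suffices to compute on lifts.  There, with G the warped metric, nabla G is
    zero on every mixed triple and equals (f2^v)^2 nabla_1 g1, resp.
    (f1^h)^2 nabla_2 g2, on purely horizontal, resp. vertical, triples.  The torsion
    T of nabla is zero on mixed pairs and T(X^h, Y^h) is
    T_1(X, Y)^h - c f1^h f2^v (T_1(X, Y) f1)^h grad(f2^v), which vanishes exactly
    when T_1(X, Y) does; similarly for vertical pairs. *)
Require Import Defs.
From mathcomp Require Import all_boot all_order all_algebra.
From mathcomp Require Import all_classical all_reals all_analysis.
From mathcomp Require Import ring lra.
Set Implicit Arguments.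
Unset Strict Implicit.
Unset Printing Implicit Defensive.
Import Order.TTheory GRing.Theory Num.Theory.
Import numFieldNormedType.Exports.
(* [dim] is the dimension of a manifold again, not that of a vector space. *)
Import Defs.
Local Open Scope classical_set_scope.
Local Open Scope ring_scope.

(** Tangent vectors act on global functions, connections act on global fields, and the formulas for
    the induced connection speak of lifts of global fields. A coordinate function or a coordinate
    field is none of these, so it is first multiplied by a bump function built from exp(-1/t).
    Nothing is ever divided by a bump function: identities carry its powers, which are cancelled at
    the one point where it is known to be nonzero. The gradients on the product are never computed.
    The bound on c makes G positive definite through Cauchy-Schwarz, so they exist, and after that
    only G(grad f, Z) = Z(f) is used. The form B and the mixed formula are balanced so that the
    mixed components of nabla G cancel identically, whatever the two base connections are. The mixed
    torsion needs [X^h, Y^v] = 0, which comes down to the symmetry of second derivatives. *)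

(** * The flat function exp(-1/t) and its derivatives *)

Section Flat.
Context {R : realType}.

(* The powers of t make the family closed under differentiation. *)
Definition flat (n : nat) (t : R) : R :=
  if 0 < t then expR (- t^-1) / t ^+ n else 0.

(** With m = n+2, exp(1/t) = exp(1/(mt))^m is at least (1/(mt))^m, so exp(-1/t) is at most (mt)^m.
    The choice of m leaves t^2 after division by t^n, enough for the derivative at 0 to vanish. *)
Lemma flat_le n t : `|flat n t| <= n.+2%:R ^+ n.+2 * t ^+ 2.
Proof.
rewrite /flat; case: ifPn => t0; last first.
  by rewrite normr0 mulr_ge0 ?sqr_ge0 // exprn_ge0.
have tn k : 0 < t ^+ k by rewrite exprn_gt0.
rewrite ger0_norm; last by rewrite divr_ge0 ?expR_ge0 // ltW.
rewrite ler_pdivrMr // -mulrA -exprD addnC addn2 -exprMn.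
have m0 : 0 < n.+2%:R * t :> R by rewrite mulr_gt0 // ltr0n.
have -> : - t^-1 = - (n.+2%:R * (n.+2%:R * t)^-1).
  by field; rewrite gt_eqF //= -natrD pnatr_eq0.
rewrite expRN expRM_natl -exprVn lerXn2r ?nnegrE ?invr_ge0 ?expR_ge0 ?(ltW m0) //.
rewrite invf_ple ?posrE ?expR_gt0 //.
by apply: le_trans (expR_ge1Dx _); rewrite lerDr.
Qed.

Lemma is_derive0_quadratic (f : R -> R) (C : R) :
  (forall t, `|f t| <= C * t ^+ 2) -> is_derive (0 : R) 1 f 0.
Proof.
move=> fC.
have f0 : f 0 = 0 by apply/normr0_eq0/le_anti; rewrite normr_ge0 (le_trans (fC 0)) // expr0n mulr0.
have C0 : 0 <= C by have := le_trans (normr_ge0 _) (fC 1); rewrite expr1n mulr1.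
have H : (fun h : R => h^-1 *: ((f \o shift 0) (h *: 1) - f 0)) @ 0^' --> (0 : R).
  apply/cvgr0Pnorm_le => e e0; near=> h.
  rewrite /= f0 subr0 addr0 normrM normfV [h *: 1]mulr1.
  have h0 : 0 < `|h| by rewrite normr_gt0; near: h; exact: nbhs_dnbhs_neq.
  rewrite mulrC ler_pdivrMr //; apply: le_trans (fC h) _.
  rewrite -(@real_normK _ h) ?num_real // expr2 mulrA.
  rewrite ler_wpM2r //.
  (* C may be 0, hence the denominator C + 1. *)
  have : `|h| <= e / (C + 1).
    by near: h; apply: dnbhs0_le; rewrite divr_gt0 // ltr_wpDl.
  rewrite ler_pdivlMr ?ltr_wpDl // => /(le_trans _); apply.
  by rewrite mulrC ler_wpM2l // lerDl.
by split; [apply/cvg_ex; exists 0|exact: cvg_lim].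
Unshelve. all: by end_near. Qed.

Lemma is_derive_flat n (t : R) :
  is_derive t 1 (flat n) (flat n.+2 t - n%:R * flat n.+1 t).
Proof.
have [t0|t0|->] := ltgtP t 0.
- have -> : flat n.+2 t - n%:R * flat n.+1 t = 0.
    by rewrite /flat !ltNge (ltW t0) /= mulr0 subr0.
  apply: (@near_eq_is_derive _ _ _ (cst 0)) => //.
    by near=> s; rewrite /flat ltNge ltW //; near: s; exact: lt_nbhsl.
- have tN0 : t != 0 by rewrite gt_eqF.
  apply: (@near_eq_is_derive _ _ _ (fun s : R => expR (- s^-1) * (s^-1) ^+ n)).
    by near=> s; rewrite /flat ifT ?exprVn //; near: s; exact: lt_nbhsr.
  have e1 : is_derive t 1 (fun s : R => s^-1) (- t ^- 2).
    apply: is_derive_eq (is_deriveV tN0 (is_derive_id t 1)) _.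
    by rewrite /GRing.scale /= mulr1.
  have e2 : is_derive t 1 (fun s : R => expR (- s^-1)) (expR (- t^-1) * - - t ^- 2).
    exact: (@is_derive1_comp _ expR (fun s => - s^-1) _ _ _ (is_derive_expR _) (is_deriveN e1)).
  have := is_deriveM e2 (is_deriveX n e1).
  rewrite (_ : _ * _ = (fun s : R => expR (- s^-1) * (s^-1) ^+ n)); last first.
    by apply/funext => s; rewrite fctE /= exprfctE.
  move=> /is_derive_eq; apply.
  rewrite /flat t0 /GRing.scale /= opprK exprfctE.
  case: n => [|n] /=.
    by rewrite expr0; field.
  by rewrite !exprVn !exprS expr0; field; rewrite tN0 expf_neq0.
- by rewrite /flat ltxx mulr0 subr0; apply: is_derive0_quadratic (flat_le n).
Unshelve. all: by end_near. Qed.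

(** The induction on k generalizes over m, since differentiating [flat m] produces [flat m.+2] and
    [flat m.+1]. *)
Lemma Ck_flat k m n (U : set 'rV[R]_n) (s : 'rV[R]_n -> R) : open U ->
  Ck k U s -> Ck k U (fun x => flat m (s x)).
Proof.
move=> oU; elim: k m => [|k IH] m.
  move=> cs x Ux; apply: (@continuous_comp _ _ _ s (flat m)); first exact: cs.
  have [df _] := is_derive_flat m (s x).
  exact/differentiable_continuous/derivable1_diffP.
move=> /[dup] Cs [ds Ds].
have dl x : U x -> is_diff x (fun x => flat m (s x))
    ( *%R (flat m.+2 (s x) - m%:R * flat m.+1 (s x)) \o 'd s x).
  move=> Ux; have [dh he] := is_derive_flat m (s x).
  have : is_diff (s x) (flat m) ( *%R (flat m.+2 (s x) - m%:R * flat m.+1 (s x))).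
    apply: DiffDef; first exact/derivable1_diffP.
    by rewrite deriv1E //; apply/funext => y; rewrite derive1E he /GRing.scale/= mulrC.
  by apply: is_diff_comp; apply: differentiableP; exact: ds.
split=> [x Ux|v]; first by have [] := dl _ Ux.
have C' := CkD oU (IH m.+2 (CkS Cs)) (CkM oU (Ck_cst k U (- m%:R)) (IH m.+1 (CkS Cs))).
apply: Ck_eq (CkM oU C' (Ds v)) => // x Ux.
have [H1 H2] := dl _ Ux.
by rewrite (deriveE _ H1) H2 /= mulNr deriveE //; exact: ds.
Qed.

End Flat.

(** * Bump functions on a manifold *)

Section Bump.
Context {R : realType} {M : manifold R}.

(** The chart domain and the complement of K are open and cover M. On the first, f is smooth through
    a change of coordinates; on the second it is 0. *)
Lemma smooth_glue (a : chart R (dim M) M) (K : set M) (f : M -> R) :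
  atlas M a -> closed K -> K `<=` chart_dom a -> (forall q, ~ K q -> f q = 0) ->
  smooth_on (chart_cod a) (f \o chart_inv a) -> smooth f.
Proof.
move=> aM cK Ka f0 sf b bM k; apply: Ck_local => _ [q bq <-].
have [aq|naq] := pselect (chart_dom a q).
  have oV := @chart_image_open _ _ _ b _ (chart_dom_open a).
  exists (b @` (chart_dom b `&` chart_dom a)); split=> //; first by exists q.
  apply: (@Ck_eq _ _ _ _ ((f \o chart_inv a) \o (a \o chart_inv b))) => //.
    by move=> _ [r [br ar] <-] /=; rewrite !chart_mapK.
  apply: (Ck_comp oV _ _ (sf k)) => [|j]; last exact: atlas_smooth.
  by move=> _ [r [br ar] <-] /=; rewrite chart_mapK //; exact: chart_codP.
have oV := @chart_image_open _ _ _ b _ (closed_openC cK).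
exists (b @` (chart_dom b `&` ~` K)); split=> //; first by exists q; split=> // /Ka.
by apply: Ck_eq (Ck_cst k _ 0) => // _ [r [br Kr] <-] /=; rewrite chart_mapK ?f0.
Qed.

(** A closed cube in the chart is compact, so its image is compact, and closed in all of M because M
    is Hausdorff. Closedness in M, and not merely in the chart domain, is what [smooth_glue]
    requires. *)
Lemma closed_ball_chart (a : chart R (dim M) M) (p : M) : chart_dom a p ->
  exists2 r : R, 0 < r & let B := [set x : 'rV[R]_(dim M) |
     forall i, `|x ord0 i - a p ord0 i| <= r] in
  B `<=` chart_cod a /\ closed (chart_inv a @` B).
Proof.
move=> ap.
have : \forall y \near a p, chart_cod a y.
  by apply: open_nbhs_nbhs; split; [exact: cod_open|exact: chart_codP].
move=> /nbhs_ballP[e /= e0 eB]; exists (e / 2); first exact: divr_gt0.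
set B := [set x | _]; have Bcod : B `<=` chart_cod a.
  move=> x Bx; apply: eB; split=> // i j; rewrite (ord1 i) /ball /= distrC.
  by apply: le_lt_trans (Bx j) _; rewrite ltr_pdivrMr // ltr_pMr // ltr1n.
split=> //; apply: compact_closed; first exact: manifold_hausdorff.
apply: continuous_compact.
  apply: continuous_in_subspaceT => x /set_mem /Bcod; exact: chart_inv_continuous.
have -> : B = [set v : 'rV[R]_(dim M) | forall i,
    `[a p ord0 i - e / 2, a p ord0 i + e / 2]%classic (v ord0 i)].
  by apply/seteqP; split=> x Bx i; move: (Bx i); rewrite /= in_itv /= ler_distl.
by apply: (@rV_compact R _ (fun i => `[a p ord0 i - e / 2, a p ord0 i + e / 2]%classic)) => i; exact: segment_compact.
Qed.

(** The function is exp(-1/s) with s = r^2 - |x - a(p)|^2, positive only in the Euclidean ball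
    inscribed in the cube of [closed_ball_chart]. Off the chart domain the values of [a] are
    arbitrary, so 0 is imposed there. K is returned as well, to allow gluing other objects
    multiplied by the bump. *)
Lemma bump (a : chart R (dim M) M) (p : M) : atlas M a -> chart_dom a p ->
  exists (chi : smooth_fun M) (K : set M),
    [/\ chi p != 0, closed K, K `<=` chart_dom a & forall q, ~ K q -> chi q = 0].
Proof.
move=> aM ap; have [r r0 [Bcod cK]] := closed_ball_chart ap.
set K := _ @` _ in cK.
pose s (x : 'rV[R]_(dim M)) : R := r ^+ 2 - \sum_i (x ord0 i - a p ord0 i) ^+ 2.
pose chi (q : M) : R := if pselect (chart_dom a q) then flat 0 (s (a q)) else 0.
have Ka : K `<=` chart_dom a by move=> _ [x /Bcod /chart_invP[] ? _ <-].
have chi0 q : ~ K q -> chi q = 0.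
  move=> Kq; rewrite /chi; case: pselect => // aq; rewrite /flat ifF //.
  apply/negbTE; apply: contra_notN Kq => sq; exists (a q); last exact: chart_mapK.
  move=> i /=; rewrite -(@ler_pXn2r _ 2) ?nnegrE ?(ltW r0) // real_normK ?num_real //.
  apply/ltW; move: sq; rewrite /s subr_gt0; apply: le_lt_trans.
  by rewrite (bigD1 i) //= lerDl sumr_ge0 // => j _; exact: sqr_ge0.
have Cs k : Ck k (chart_cod a) s.
  have oU := cod_open a.
  have C i : Ck k (chart_cod a) (fun x => (x ord0 i - a p ord0 i) ^+ 2).
    have Ci := CkD oU (Ck_coord k _ i) (Ck_cst k _ (- a p ord0 i)).
    by apply: Ck_eq oU _ (CkM oU Ci Ci) => x _; rewrite expr2.
  have := CkD oU (Ck_cst k _ (r ^+ 2)) (CkM oU (Ck_cst k _ (-1)) (Ck_sum oU C)).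
  by apply: Ck_eq => // x _; rewrite mulN1r.
have schi : smooth chi.
  apply: (smooth_glue aM cK Ka chi0) => k.
  apply: Ck_eq (Ck_flat 0 (cod_open a) (Cs k)); first exact: cod_open.
  by move=> _ [q aq <-] /=; rewrite /chi chart_mapK //; case: pselect.
exists (mk_smooth schi), K; split=> //=.
rewrite /chi; case: pselect => // ap0; rewrite /flat /s big1 ?subr0 ?exprn_gt0 //.
  by apply: mulf_neq0; [rewrite gt_eqF ?expR_gt0|rewrite invr_eq0 expr0 oner_neq0].
by move=> i _; rewrite subrr expr0n.
Qed.

End Bump.

(** * Derivation rules, components of tangent vectors, local frames *)

Section TangentVectors.
Context {R : realType} {M : manifold R}.
Implicit Types (f h : smooth_fun M) (a b : chart R (dim M) M).

Lemma smooth_funDE f h p : (f + h) p = f p + h p. Proof. by []. Qed.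
Lemma smooth_funNE f p : (- f) p = - f p. Proof. by []. Qed.
Lemma smooth_funBE f h p : (f - h) p = f p - h p. Proof. by []. Qed.
Lemma smooth_funME f h p : (f * h) p = f p * h p. Proof. by []. Qed.
Lemma smooth_funZE (c : R) f p : (c *: f) p = c * f p. Proof. by []. Qed.
Lemma smooth_fun0E p : (0 : smooth_fun M) p = 0. Proof. by []. Qed.
Lemma smooth_funXE f n p : (f ^+ n) p = f p ^+ n.
Proof. by elim: n => [|n IH]; rewrite ?expr0 // !exprS smooth_funME IH. Qed.

Lemma tangent_mul p (u : tangent p) f h : u (f * h) = f p * u h + h p * u f.
Proof.
have [a aM ap] := atlas_cover p; have [xi uE] := tangentP u aM ap.
rewrite !uE /chart_deriv.
have := @deriveM _ _ (f \o chart_inv a) (h \o chart_inv a) (a p) xi.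
rewrite /GRing.scale /= chart_mapK // => <- //; exact/diff_derivable/chart_diff.
Qed.

Lemma tangent_add p (u : tangent p) f h : u (f + h) = u f + u h.
Proof.
have [a aM ap] := atlas_cover p; have [xi uE] := tangentP u aM ap.
rewrite !uE /chart_deriv.
rewrite -(@deriveD _ _ _ (f \o chart_inv a) (h \o chart_inv a) (a p) xi) //;
  exact/diff_derivable/chart_diff.
Qed.

Lemma tangent_scale p (u : tangent p) (c : R) f : u (c *: f) = c * u f.
Proof.
have [a aM ap] := atlas_cover p; have [xi uE] := tangentP u aM ap.
rewrite !uE /chart_deriv.
rewrite -[RHS](@deriveZ _ _ _ (f \o chart_inv a) c (a p) xi) //;
  exact/diff_derivable/chart_diff.
Qed.

Lemma tangent_ln p (u : tangent p) f (f0 : forall q, 0 < f q) :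
  u (ln_fun f0) = u f / f p.
Proof.
have [a aM ap] := atlas_cover p; have [xi uE] := tangentP u aM ap.
rewrite !uE /chart_deriv; have df := chart_diff f aM ap.
have := is_diff_comp (differentiableP df) (is_diff_ln (f0 (chart_inv a (a p)))).
rewrite /comp /= => -[H1 H2].
rewrite (deriveE _ H1) H2 /= chart_mapK // deriveE // mulrC.
by congr (_ * _).
Qed.

Lemma tangentDE p (u v : tangent p) f : (u + v) f = u f + v f. Proof. by []. Qed.
Lemma tangentZE p (u : tangent p) (c : R) f : (c *: u) f = c * u f. Proof. by []. Qed.
Lemma tangent_sumE p n (u : 'I_n -> tangent p) f : (\sum_i u i) f = \sum_i u i f.
Proof.
by elim: n u => [|n IH] u; rewrite ?big_ord0 // !big_ord_recl tangentDE IH.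
Qed.

Lemma tangent_cst p (u : tangent p) f (c : R) :
  (forall q, f q = c) -> u f = 0.
Proof.
move=> fc; have -> : f = c *: (1 : smooth_fun M).
  by apply: smooth_fun_ext => q; rewrite fc smooth_funZE mulr1.
rewrite tangent_scale; suff -> : u 1 = 0 by rewrite mulr0.
by have /eqP := tangent_mul u 1 1; rewrite mulr1 mul1r addrC -subr_eq subrr eq_sym => /eqP.
Qed.

Lemma vfieldDE (X Y : vfield M) p : (X + Y) p = X p + Y p.
Proof. by []. Qed.
Lemma vfieldZE (f : smooth_fun M) (X : vfield M) p :
  (f *: X) p = f p *: X p.
Proof. by []. Qed.

Lemma vfield_sumE n (X : 'I_n -> vfield M) p :
  (\sum_i X i) p = \sum_i X i p.
Proof.
elim: n X => [|n IH] X; first by rewrite !big_ord0.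
by rewrite !big_ord_recl -IH.
Qed.

(** Take y_i = chi x_i, extended by 0. The last identity is the quotient rule for x_i = y_i / chi
    multiplied by chi^2, so it recovers the i-th component from global functions and makes sense
    where chi vanishes too. *)
Lemma chart_functions a p : atlas M a -> chart_dom a p ->
  exists (chi : smooth_fun M) (K : set M) (y : 'I_(dim M) -> smooth_fun M),
    [/\ chi p != 0, [/\ closed K, K `<=` chart_dom a & forall q, ~ K q -> chi q = 0],
      forall i q, chi q = 0 -> y i q = 0 &
      forall i q xi, chart_dom a q ->
        chi q * chart_deriv a q xi (y i) - y i q * chart_deriv a q xi chi
        = chi q ^+ 2 * xi ord0 i].
Proof.
move=> aM ap; have [chi [K [chip cK Ka chi0]]] := bump aM ap.
have sy i : smooth (fun q => chi q * a q ord0 i).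
  apply: (smooth_glue aM cK Ka) => [q /chi0 ->|k]; first by rewrite mul0r.
  apply: Ck_eq (CkM (cod_open a) (smooth_funP chi aM k) (Ck_coord k _ i)).
    exact: cod_open.
  by move=> x /chart_invP[ax xE] /=; rewrite xE.
exists chi, K, (fun i => mk_smooth (sy i)); split=> //.
  by move=> i q /= ->; rewrite mul0r.
move=> i q xi aq.
have -> : chart_deriv a q xi (mk_smooth (sy i)) =
    chi q * xi ord0 i + a q ord0 i * chart_deriv a q xi chi.
  have dchi := chart_diff chi aM aq.
  have dc : differentiable (fun x : 'rV[R]_(dim M) => x ord0 i : R) (a q).
    exact: differentiable_coord.
  transitivity ('D_xi ((chi \o chart_inv a) * (fun x => x ord0 i : R)) (a q)).
    apply: near_eq_derive; apply: near_open (cod_open a) (chart_codP aq) _.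
    by move=> x /chart_invP[ax xE] /=; rewrite xE.
  rewrite deriveM; try exact: diff_derivable.
  by rewrite derive_row // derive_id /GRing.scale /= chart_mapK.
rewrite /=; ring.
Qed.

Lemma chart_deriv_inj a p xi eta : atlas M a -> chart_dom a p ->
  chart_deriv a p xi =1 chart_deriv a p eta -> xi = eta.
Proof.
move=> aM ap xe; have [chi [K [y [chip _ _ yE]]]] := chart_functions aM ap.
apply/rowP => i; apply: (@mulfI _ (chi p ^+ 2)); first exact: expf_neq0.
by rewrite -!yE // !xe.
Qed.

(** The coordinate field of constant components xi, multiplied by chi, extends by 0 because chi
    vanishes off a closed subset of the chart domain. *)
Lemma chart_field a (K : set M) (chi : smooth_fun M) xi : atlas M a ->
  closed K -> K `<=` chart_dom a -> (forall q, ~ K q -> chi q = 0) ->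
  exists X : vfield M, forall q f, chart_dom a q ->
    X q f = chi q * chart_deriv a q xi f.
Proof.
move=> aM cK Ka chi0.
have ex q : {w : tangent q | chart_dom a q -> w =1 chart_deriv a q xi}.
  have [aq|naq] := pselect (chart_dom a q); last by exists 0.
  by have [w wE] := cid (chart_tangent xi aM aq); exists w.
pose w q := projT1 (ex q); have wE q : chart_dom a q -> w q =1 chart_deriv a q xi.
  exact: (projT2 (ex q)).
pose F b := b \o smooth_id M \o chart_inv a.
have VP b : atlas M b -> exists2 Xi : 'rV[R]_(dim M) -> 'rV[R]_(dim M),
    smooth_map_on (chart_cod b) Xi &
    forall q, chart_dom b q -> chi q *: w q =1 chart_deriv b q (Xi (b q)).
  move=> bM.
  (* Components in the chart b: chi times the derivative along xi of the transition map from a to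
     b. *)
  exists (fun x => if pselect (chart_dom a (chart_inv b x)) then
    chi (chart_inv b x) *: 'D_xi (F b) (a (chart_inv b x)) else 0).
    move=> j k; apply: Ck_local => _ [q bq <-].
    have [aq|naq] := pselect (chart_dom a q).
      have oV := @chart_image_open _ _ _ b _ (chart_dom_open a).
      exists (b @` (chart_dom b `&` chart_dom a)); split=> //; first by exists q.
      have C1 : Ck k (b @` (chart_dom b `&` chart_dom a)) (chi \o chart_inv b).
        by apply: (Ck_sub _ (smooth_funP chi bM k)) => _ [r [br _] <-]; exact: chart_codP.
      have C2 : Ck k (b @` (chart_dom b `&` chart_dom a))
          ('D_xi (fun x => F b x ord0 j) \o (a \o chart_inv b)).
        apply: (Ck_comp oV _ _ ((atlas_smooth aM bM j k.+1).2 xi)) => [|i].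
          by move=> _ [r [br ar] <-]; exists r; rewrite //= chart_mapK.
        exact: atlas_smooth.
      apply: Ck_eq oV _ (CkM oV C1 C2) => _ [r [br ar] <-] /=.
      rewrite chart_mapK //; case: pselect => // ar'; rewrite mxE derive_row //.
      exact: (@smap_diff _ _ _ (smooth_id M)).
    have oV := @chart_image_open _ _ _ b _ (closed_openC cK).
    exists (b @` (chart_dom b `&` ~` K)); split=> //; first by exists q; split=> // /Ka.
    apply: Ck_eq (Ck_cst k _ 0) => // _ [r [br Kr] <-] /=; rewrite chart_mapK //.
    by case: pselect => ar /=; rewrite ?chi0 // ?scale0r mxE.
  move=> q bq f; rewrite tangentZE chart_mapK //; case: pselect => aq /=.
    rewrite chart_derivZ // wE //; congr (_ * _).
    exact: (@smap_deriv _ _ _ (smooth_id M)).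
  by rewrite chi0 ?mul0r; [rewrite /chart_deriv derive0|move=> /Ka].
by exists (Vfield VP) => q f aq; rewrite tangentZE wE.
Qed.

(* The coefficient of E_i is chi^2 times the i-th component of u; written this
   way it only involves globally defined functions. *)
Lemma local_frame (p : M) : exists (chi : smooth_fun M)
    (y : 'I_(dim M) -> smooth_fun M) (E : 'I_(dim M) -> vfield M),
  chi p != 0 /\ forall q (u : tangent q),
    chi q ^+ 3 *: u = \sum_i (chi q * u (y i) - y i q * u chi) *: E i q.
Proof.
have [a aM ap] := atlas_cover p.
have [chi [K [y [chip [cK Ka chi0] y0 yE]]]] := chart_functions aM ap.
pose E i := projT1 (cid (chart_field (delta_mx ord0 i) aM cK Ka chi0)).
have EE i q f : chart_dom a q ->
    E i q f = chi q * chart_deriv a q (delta_mx ord0 i) f.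
  exact: (projT2 (cid (chart_field (delta_mx ord0 i) aM cK Ka chi0))).
exists chi, y, E; split=> // q u; apply: tangent_ext => f.
have [aq|naq] := pselect (chart_dom a q); last first.
  have c0 : chi q = 0 by apply: (chi0 q) => /Ka.
  rewrite c0 expr0n scale0r big1 // => i _.
  by rewrite y0 // !mul0r subr0 scale0r.
rewrite tangentZE tangent_sumE; have [xi uE] := tangentP u aM aq.
rewrite uE {1}/chart_deriv derive_coord ?mulr_sumr; last exact: chart_diff.
apply: eq_bigr => i _; rewrite tangentZE EE // !uE yE // /chart_deriv; ring.
Qed.

End TangentVectors.

(** * Symmetry of second directional derivatives *)

Section Schwarz.
Context {R : realType} {n : nat}.
Implicit Types (U : set 'rV[R]_n) (f : 'rV[R]_n -> R) (v w x y : 'rV[R]_n).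

Lemma is_derive_line f v y (s : R) : derivable f (s *: v + y) v ->
  is_derive s 1 (fun t : R => f (t *: v + y)) ('D_v f (s *: v + y)).
Proof.
have E : (fun h : R => h^-1 *: (((fun t : R => f (t *: v + y)) \o shift s) (h *: 1)
     - f (s *: v + y))) =
   (fun h : R => h^-1 *: ((f \o shift (s *: v + y)) (h *: v) - f (s *: v + y))).
  by apply/funext => h /=; rewrite [h *: 1]mulr1 scalerDl addrA.
by move=> df; split; [rewrite /derivable E|rewrite /derive E].
Qed.

Lemma mvt_line f v y (h : R) : 0 < h ->
  (forall s : R, 0 <= s <= h -> differentiable f (s *: v + y)) ->
  exists2 s : R, 0 <= s <= h & f (h *: v + y) - f y = h * 'D_v f (s *: v + y).
Proof.
move=> h0 df.
have D s : s \in `[0, h] -> is_derive s 1 (fun t : R => f (t *: v + y)) ('D_v f (s *: v + y)).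
  by rewrite in_itv /= => sh; apply/is_derive_line/diff_derivable/df.
have [s sh E] := @MVT_segment _ (fun t : R => f (t *: v + y)) (fun s => 'D_v f (s *: v + y)) _ _ (ltW h0)
  (fun s sh => D s (subset_itv_oo_cc sh)) (derivable_within_continuous (fun s sh => @ex_derive _ _ _ _ _ _ _ (D s sh))).
exists s; first by move: sh; rewrite in_itv.
by move: E; rewrite scale0r add0r subr0 mulrC.
Qed.

(** The mean value theorem is applied twice: along v to y -> f(hw + y) - f(y), then along w to the
    derivative of f along v. *)
Lemma second_difference f v w x (h : R) : 0 < h ->
  (forall s t : R, 0 <= s <= h -> 0 <= t <= h ->
     differentiable f (t *: w + (s *: v + x)) /\
     differentiable ('D_v f) (t *: w + (s *: v + x))) ->
  exists s t : R, [/\ 0 <= s <= h, 0 <= t <= h &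
    f (h *: w + (h *: v + x)) - f (h *: v + x) - (f (h *: w + x) - f x)
    = h ^+ 2 * 'D_w ('D_v f) (t *: w + (s *: v + x))].
Proof.
move=> h0 df.
have hh : (0 <= h <= h)%R by rewrite lexx ltW.
have h00 : ((0 : R) <= 0 <= h)%R by rewrite lexx ltW.
pose F y := f (h *: w + y).
have dF (s : R) : 0 <= s <= h -> differentiable F (s *: v + x).
  move=> sh; apply: (@differentiable_comp _ _ _ _ (fun y => h *: w + y) f).
    by apply: differentiableD; [exact: differentiable_cst|exact: ex_diff].
  by have [] := df s h sh hh.
have df0 (s : R) : 0 <= s <= h -> differentiable f (s *: v + x).
  by move=> sh; have [] := df s 0 sh h00; rewrite scale0r add0r.
have [s sh sE] := @mvt_line (F - f) v x h h0 (fun s sh => differentiableB (dF s sh) (df0 s sh)).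
have [t th tE] := @mvt_line ('D_v f) w (s *: v + x) h h0 (fun t th => (df s t sh th).2).
exists s, t; split=> //.
have dFE : 'D_v F (s *: v + x) = 'D_v f (h *: w + (s *: v + x)).
  by apply: derive_along => k; rewrite /F addrCA.
rewrite expr2 -mulrA -tE -dFE; apply: (etrans sE).
rewrite deriveB //; [exact/diff_derivable/dF|exact/diff_derivable/df0].
Qed.

(** The second difference is symmetric in v and w, so the two iterated derivatives take a common
    value, each at some point near x. If they differed at x by |A - B|, continuity would put this
    value at distance less than |A - B|/2 from both A and B. *)
Lemma derive_sym U f v w x : open U -> Ck 2 U f -> U x ->
  'D_w ('D_v f) x = 'D_v ('D_w f) x.
Proof.
move=> oU [df Df] Ux; apply/eqP; apply: contraT => neq.
set A := 'D_w _ _ in neq *; set B := 'D_v _ _ in neq *.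
have e0 : 0 < `|A - B| / 2 by rewrite divr_gt0 // normr_gt0 subr_eq0.
have : \forall y \near x, U y /\ (`|A - 'D_w ('D_v f) y| < `|A - B| / 2 /\
    `|B - 'D_v ('D_w f) y| < `|A - B| / 2).
  have n1 : \forall y \near x, U y by exact: open_nbhs_nbhs.
  have n2 : \forall y \near x, `|A - 'D_w ('D_v f) y| < `|A - B| / 2.
    by have /cvgrPdist_lt := ((Df v).2 w x Ux); apply.
  have n3 : \forall y \near x, `|B - 'D_v ('D_w f) y| < `|A - B| / 2.
    by have /cvgrPdist_lt := ((Df w).2 v x Ux); apply.
  exact: filterI n1 (filterI n2 n3).
move=> /nbhs_normP[r /= r0 rP].
have vw0 : 0 < `|v| + `|w| + 1 by rewrite ltr_wpDl // addr_ge0.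
(* Keeps every tw + sv + x with s, t in [0, h] within r of x; the summand 1 covers v = w = 0. *)
pose h := r / 2 / (`|v| + `|w| + 1).
have h0 : 0 < h by rewrite !divr_gt0.
have near_x s t : 0 <= s <= h -> 0 <= t <= h -> `|x - (t *: w + (s *: v + x))| < r.
  move=> /andP[s0 sh] /andP[t0 th]; rewrite addrA opprD addrCA subrr addr0 normrN.
  apply: le_lt_trans (ler_normD _ _) _; rewrite !normrZ !ger0_norm //.
  apply: (@le_lt_trans _ _ (h * (`|v| + `|w| + 1))).
    rewrite !mulrDr mulr1.
    by have := ler_wpM2r (normr_ge0 w) th; have := ler_wpM2r (normr_ge0 v) sh; lra.
  by rewrite /h divfK ?gt_eqF // ltr_pdivrMr // ltr_pMr // ltr1n.
have [s [t [sh th E1]]] : exists s t : R, [/\ 0 <= s <= h, 0 <= t <= h &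
    f (h *: w + (h *: v + x)) - f (h *: v + x) - (f (h *: w + x) - f x)
    = h ^+ 2 * 'D_w ('D_v f) (t *: w + (s *: v + x))].
  apply: second_difference => // s t sh th.
  have [Uy _] := rP _ (near_x _ _ sh th).
  by split; [exact: df|exact: (Df v).1].
have [s' [t' [sh' th' E2]]] : exists s t : R, [/\ 0 <= s <= h, 0 <= t <= h &
    f (h *: v + (h *: w + x)) - f (h *: w + x) - (f (h *: v + x) - f x)
    = h ^+ 2 * 'D_v ('D_w f) (t *: v + (s *: w + x))].
  apply: second_difference => // s' t' sh' th'.
  have [Uy _] := rP _ (near_x _ _ th' sh').
  by rewrite addrCA; split; [exact: df|exact: (Df w).1].
have E : 'D_w ('D_v f) (t *: w + (s *: v + x)) = 'D_v ('D_w f) (t' *: v + (s' *: w + x)).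
  apply: (@mulfI _ (h ^+ 2)); first by rewrite expf_neq0 // gt_eqF.
  have C : h *: v + (h *: w + x) = h *: w + (h *: v + x) by exact: addrCA.
  have K (b1 b2 b3 b4 : R) : b1 - b2 - (b3 - b4) = b1 - b3 - (b2 - b4) by ring.
  by apply: (etrans (esym E1)); apply: etrans E2; rewrite C; exact: K.
have [_ [a1 _]] := rP _ (near_x _ _ sh th).
have [_ [_ a2]] := rP _ (near_x _ _ th' sh').
rewrite addrCA in a2.
have := ler_normB (A - 'D_w ('D_v f) (t *: w + (s *: v + x))) (B - 'D_w ('D_v f) (t *: w + (s *: v + x))).
rewrite opprB addrA subrK; rewrite {2}E => H.
have := le_lt_trans H (ltrD a1 a2).
by rewrite -splitr ltxx.
Qed.

End Schwarz.

(** * Bilinearity of tensors, Cauchy-Schwarz, existence of gradients *)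

Section Gradient.
Context {R : realType}.

Lemma Ck_bigsum k n (U : set 'rV[R]_n) (I : Type) (r : seq I)
    (F : I -> 'rV[R]_n -> R) : open U ->
  (forall i, Ck k U (F i)) -> Ck k U (fun x => \sum_(i <- r) F i x).
Proof.
move=> oU CF; elim: r => [|i r IH].
  by apply: Ck_eq (Ck_cst k U 0) => // x _; rewrite big_nil.
by apply: Ck_eq (CkD oU (CF i) IH) => // x _; rewrite big_cons.
Qed.

Lemma Ck_bigprod k n (U : set 'rV[R]_n) (I : Type) (r : seq I)
    (F : I -> 'rV[R]_n -> R) : open U ->
  (forall i, Ck k U (F i)) -> Ck k U (fun x => \prod_(i <- r) F i x).
Proof.
move=> oU CF; elim: r => [|i r IH].
  by apply: Ck_eq (Ck_cst k U 1) => // x _; rewrite big_nil.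
by apply: Ck_eq (CkM oU (CF i) IH) => // x _; rewrite big_cons.
Qed.

Lemma Ck_det k m n (U : set 'rV[R]_m) (A : 'rV[R]_m -> 'M[R]_n) : open U ->
  (forall i j, Ck k U (fun x => A x i j)) -> Ck k U (fun x => \det (A x)).
Proof.
move=> oU CA; apply: Ck_bigsum => // s.
by apply: CkM => //; [exact: Ck_cst|exact: Ck_bigprod].
Qed.

(** By the adjugate formula, each entry of the inverse is a signed minor divided by the
    determinant. *)
Lemma Ck_invmx k m n (U : set 'rV[R]_m) (A : 'rV[R]_m -> 'M[R]_n) i j : open U ->
  (forall x, U x -> A x \in unitmx) ->
  (forall i j, Ck k U (fun x => A x i j)) -> Ck k U (fun x => invmx (A x) i j).
Proof.
move=> oU uA CA.
have C1 : Ck k U (fun x => (\det (A x))^-1).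
  apply: CkV => //; last exact: Ck_det.
  by move=> x /uA; rewrite unitmxE unitfE.
have C2 : Ck k U (fun x => \det (row' j (col' i (A x)))).
  apply: Ck_det => // i' j'.
  by apply: Ck_eq (CA (lift j i') (lift i j')) => // x _; rewrite !mxE.
apply: Ck_eq (CkM oU C1 (CkM oU (Ck_cst k U ((-1) ^+ (j + i))) C2)) => // x Ux.
by rewrite /invmx uA // !mxE.
Qed.

Context {M : manifold R}.
Implicit Types (f : smooth_fun M) (g : tensor02 M).

Lemma tensor_linearl g p (c : R) (u v w : tangent p) :
  g p (c *: u + v) w = c * g p u w + g p v w.
Proof.
have [a aM ap] := atlas_cover p; have [A _ AE] := tensorP g aM.
have [x uE] := tangentP u aM ap; have [y vE] := tangentP v aM ap.
have [z wE] := tangentP w aM ap.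
have cE : c *: u + v =1 chart_deriv a p (c *: x + y).
  by move=> f; rewrite chart_derivD // chart_derivZ // -uE -vE.
rewrite (AE _ _ _ _ _ ap cE wE) (AE _ _ _ _ _ ap uE wE) (AE _ _ _ _ _ ap vE wE).
rewrite mulr_sumr -big_split; apply: eq_bigr => i _ /=.
rewrite mulr_sumr -big_split; apply: eq_bigr => j _ /=.
rewrite !mxE; ring.
Qed.

Lemma tensor_linearr g p (c : R) (u v w : tangent p) :
  g p w (c *: u + v) = c * g p w u + g p w v.
Proof.
have [a aM ap] := atlas_cover p; have [A _ AE] := tensorP g aM.
have [x uE] := tangentP u aM ap; have [y vE] := tangentP v aM ap.
have [z wE] := tangentP w aM ap.
have cE : c *: u + v =1 chart_deriv a p (c *: x + y).
  by move=> f; rewrite chart_derivD // chart_derivZ // -uE -vE.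
rewrite (AE _ _ _ _ _ ap wE cE) (AE _ _ _ _ _ ap wE uE) (AE _ _ _ _ _ ap wE vE).
rewrite mulr_sumr -big_split; apply: eq_bigr => i _ /=.
rewrite mulr_sumr -big_split; apply: eq_bigr => j _ /=.
rewrite !mxE; ring.
Qed.

Lemma tensor0l g p (w : tangent p) : g p 0 w = 0.
Proof. by have := tensor_linearl g (-1) 0 0 w; rewrite scaler0 addr0 mulN1r addNr. Qed.
Lemma tensor0r g p (w : tangent p) : g p w 0 = 0.
Proof. by have := tensor_linearr g (-1) 0 0 w; rewrite scaler0 addr0 mulN1r addNr. Qed.
Lemma tensorDl g p (u v w : tangent p) : g p (u + v) w = g p u w + g p v w.
Proof. by have := tensor_linearl g 1 u v w; rewrite scale1r mul1r. Qed.
Lemma tensorDr g p (u v w : tangent p) : g p w (u + v) = g p w u + g p w v.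
Proof. by have := tensor_linearr g 1 u v w; rewrite scale1r mul1r. Qed.
Lemma tensorZl g p (c : R) (u w : tangent p) : g p (c *: u) w = c * g p u w.
Proof. by have := tensor_linearl g c u 0 w; rewrite tensor0l !addr0. Qed.
Lemma tensorZr g p (c : R) (u w : tangent p) : g p w (c *: u) = c * g p w u.
Proof. by have := tensor_linearr g c u 0 w; rewrite tensor0r !addr0. Qed.

Lemma riemannian_ge0 g : riemannian g -> forall p (u : tangent p), 0 <= g p u u.
Proof.
move=> [_ gpos] p u; have [->|u0] := eqVneq u 0; first by rewrite tensor0l.
exact/ltW/gpos.
Qed.

Lemma riemannian_pseudo g : riemannian g -> pseudo_riemannian g.
Proof.
move=> [gs gpos]; split=> // p u u0; apply/eqP; apply: contraT => /gpos.
by rewrite u0 ltxx.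
Qed.

(** The square length of g(v,v) u - g(u,v) v equals g(v,v) times the difference of the two sides. *)
Lemma cauchy_schwarz g : riemannian g -> forall p (u v : tangent p),
  g p u v ^+ 2 <= g p u u * g p v v.
Proof.
move=> gR p u v; have [gs gpos] := gR.
have [->|v0] := eqVneq v 0; first by rewrite !tensor0r mulr0 expr0n.
have t0 := gpos _ _ v0.
have := riemannian_ge0 gR (g p v v *: u + (- g p u v) *: v).
rewrite tensor_linearl !tensor_linearr !tensorZl !tensorZr (gs _ v u) => H.
rewrite -subr_ge0 -(pmulr_rge0 _ t0).
by apply: le_trans H _; rewrite le_eqVlt; apply/orP; left; apply/eqP; ring.
Qed.

(** [grad] is an [xget] with default 0, so a smooth gradient must be exhibited. In a chart its
    component row is df A^-1, where A is the matrix of g: a row om with om A = 0 would be the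
    components of a vector orthogonal to everything. *)
Lemma gradP g f : pseudo_riemannian g -> is_grad g f (grad g f).
Proof.
move=> [gs gnd]; apply: (@xgetPex _ 0 [set W : vfield M | is_grad g f W]).
pose df a (x : 'rV[R]_(dim M)) : 'rV[R]_(dim M) :=
  \row_j 'D_(delta_mx ord0 j) (f \o chart_inv a) x.
have loc a : atlas M a -> exists2 Xi : 'rV[R]_(dim M) -> 'rV[R]_(dim M),
    smooth_map_on (chart_cod a) Xi &
    forall p (w : tangent p), chart_dom a p -> w =1 chart_deriv a p (Xi (a p)) ->
      forall v : tangent p, g p w v = v f.
  move=> aM; have [A sA AE] := tensorP g aM.
  have uA p : chart_dom a p -> A (a p) \in unitmx.
    move=> ap; rewrite -row_free_unit; apply: inj_row_free => om om0.
    have [w wE] := chart_tangent om aM ap.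
    have w0 : w = 0.
      apply: gnd => v; have [eta vE] := tangentP v aM ap.
      rewrite (AE _ _ _ _ _ ap wE vE) exchange_big big1 //= => j _.
      rewrite -mulr_suml; have := congr1 (fun B : 'rV_(dim M) => B ord0 j) om0.
      rewrite !mxE; under eq_bigr do rewrite mulrC.
      by move=> ->; rewrite mul0r.
    apply: (chart_deriv_inj aM ap) => h; rewrite -wE w0.
    by rewrite /chart_deriv derive0.
  exists (fun x => df a x *m invmx (A x)).
    move=> j k; have oU := cod_open a.
    have C i : Ck k (chart_cod a) (fun x =>
        'D_(delta_mx ord0 i) (f \o chart_inv a) x * invmx (A x) i j).
      apply: (CkM oU ((smooth_funP f aM k.+1).2 _)); apply: Ck_invmx => //.
        by move=> _ [p ap <-]; exact: uA.
      by move=> i' j'; exact: sA.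
    apply: Ck_eq (Ck_sum oU C) => // x _; rewrite mxE; apply: eq_bigr => i _.
    by rewrite mxE.
  move=> p w ap wE v; have [eta vE] := tangentP v aM ap.
  rewrite (AE _ _ _ _ _ ap wE vE) exchange_big /= vE.
  rewrite /chart_deriv derive_coord; last exact: chart_diff.
  apply: eq_bigr => j _; rewrite -mulr_suml mulrC; congr (_ * _).
  transitivity ((df a (a p) *m invmx (A (a p)) *m A (a p)) ord0 j).
    by rewrite mxE; apply: eq_bigr => i _; rewrite mulrC.
  by rewrite mulmxKV ?uA // mxE.
(* The chart used here is arbitrary at each point; nondegeneracy makes the vector unique, so in
   every chart the field agrees with the smooth local formula. *)
have ex p : {w : tangent p | forall v, g p w v = v f}.
  apply/cid; have [a aM ap] := atlas_cover p.
  have [Xi _ XiE] := loc a aM; have [w wE] := chart_tangent (Xi (a p)) aM ap.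
  by exists w; exact: XiE.
pose W p := projT1 (ex p); have WE p : forall v, g p (W p) v = v f.
  exact: (projT2 (ex p)).
have WP a : atlas M a -> exists2 Xi : 'rV[R]_(dim M) -> 'rV[R]_(dim M),
    smooth_map_on (chart_cod a) Xi &
    forall p, chart_dom a p -> W p =1 chart_deriv a p (Xi (a p)).
  move=> aM; have [Xi sXi XiE] := loc a aM; exists Xi => // p ap.
  have [w wE] := chart_tangent (Xi (a p)) aM ap.
  suff -> : W p = w by [].
  apply/eqP; rewrite -subr_eq0; apply/eqP/gnd => v.
  by rewrite tensorDl -scaleN1r tensorZl WE (XiE _ _ ap wE) mulN1r subrr.
by exists (Vfield WP) => p v; exact: WE.
Qed.

End Gradient.

(** * Tangent vectors of a product and reduction to lifts *)

Section TangentMap.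
Context {R : realType} {M N : manifold R} (phi : smooth_map M N).

Lemma tangent_mapD p (u v : tangent p) :
  tangent_map phi (u + v) = tangent_map phi u + tangent_map phi v.
Proof. exact: tangent_ext. Qed.
Lemma tangent_mapZ p (c : R) (u : tangent p) :
  tangent_map phi (c *: u) = c *: tangent_map phi u.
Proof. exact: tangent_ext. Qed.
Lemma tangent_map_sum p n
  (u : 'I_n -> tangent p) :
  tangent_map phi (\sum_i u i) = \sum_i tangent_map phi (u i).
Proof. by apply: tangent_ext => f; rewrite tangent_sumE /= tangent_sumE. Qed.

End TangentMap.

Section Product.
Context {R : realType} {M1 M2 : manifold R}.
Local Notation P := (prod_manifold M1 M2).

(** In a product chart the two projections of a vector have the left and the right half of its
    component row as components. *)
Lemma prod_tangent_inj (p : P) (u v : tangent p) :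
  tangent_map (proj1_map M1 M2) u = tangent_map (proj1_map M1 M2) v ->
  tangent_map (proj2_map M1 M2) u = tangent_map (proj2_map M1 M2) v -> u = v.
Proof.
case: p u v => p1 p2 u v uv1 uv2.
have [a1 A1 d1] := atlas_cover p1; have [a2 A2 d2] := atlas_cover p2.
pose a : chart R (dim P) P := prod_chart a1 a2.
have aP : atlas P a by exists a1, a2.
have ap : chart_dom a (p1, p2) by [].
have [xi uE] := tangentP u aP ap; have [eta vE] := tangentP v aP ap.
have D1 (w : tangent ((p1, p2) : P)) (ze : 'rV_(dim M1 + dim M2)) :
    w =1 chart_deriv a (p1, p2) ze ->
    tangent_map (proj1_map M1 M2) w =1 chart_deriv a1 p1 (lsubmx ze).
  move=> wE f; rewrite /= wE; apply: derive_along => h.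
  by rewrite /= linearD linearZ /= row_mxKl.
have D2 (w : tangent ((p1, p2) : P)) (ze : 'rV_(dim M1 + dim M2)) :
    w =1 chart_deriv a (p1, p2) ze ->
    tangent_map (proj2_map M1 M2) w =1 chart_deriv a2 p2 (rsubmx ze).
  move=> wE f; rewrite /= wE; apply: derive_along => h.
  by rewrite /= linearD linearZ /= row_mxKr.
have l : lsubmx xi = lsubmx eta.
  by apply: (chart_deriv_inj A1 d1) => f; rewrite -(D1 _ _ uE) -(D1 _ _ vE) uv1.
have r : rsubmx xi = rsubmx eta.
  by apply: (chart_deriv_inj A2 d2) => f; rewrite -(D2 _ _ uE) -(D2 _ _ vE) uv2.
by apply: tangent_ext => f; rewrite uE vE -(hsubmxK xi) l r hsubmxK.
Qed.

Lemma hlift_proj1 (X : vfield M1) (p : P) :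
  tangent_map (proj1_map M1 M2) (hlift M2 X p) = X p.1.
Proof. exact: (hliftP M2 X).1. Qed.
Lemma hlift_proj2 (X : vfield M1) (p : P) :
  tangent_map (proj2_map M1 M2) (hlift M2 X p) = 0.
Proof. exact: (hliftP M2 X).2. Qed.
Lemma vlift_proj1 (X : vfield M2) (p : P) :
  tangent_map (proj1_map M1 M2) (vlift M1 X p) = 0.
Proof. exact: (vliftP M1 X).1. Qed.
Lemma vlift_proj2 (X : vfield M2) (p : P) :
  tangent_map (proj2_map M1 M2) (vlift M1 X p) = X p.2.
Proof. exact: (vliftP M1 X).2. Qed.

Definition lift_projE := (hlift_proj1, hlift_proj2, vlift_proj1, vlift_proj2).

(** At each point some function that is nonzero there makes its product with X a combination of
    lifts of frame fields; linearity of [Phi] over functions then gives [Phi X] = 0 at that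
    point. *)
Lemma eq_on_lifts (Phi : vfield P -> smooth_fun P) :
  (forall f X Y, Phi (f *: X + Y) = f * Phi X + Phi Y) ->
  (forall X1, Phi (hlift M2 X1) = 0) -> (forall X2, Phi (vlift M1 X2) = 0) ->
  forall X, Phi X = 0.
Proof.
move=> PhiL PhiH PhiV X.
have Phi0 : Phi 0 = 0.
  by have := PhiL (-1) 0 0; rewrite scaler0 addr0 mulN1r addNr.
have PhiZ f Y : Phi (f *: Y) = f * Phi Y.
  by have := PhiL f Y 0; rewrite Phi0 !addr0.
have PhiD Y Z : Phi (Y + Z) = Phi Y + Phi Z.
  by have := PhiL 1 Y Z; rewrite scale1r mul1r.
have PhiS n (Y : 'I_n -> vfield P) : (forall i, Phi (Y i) = 0) -> Phi (\sum_i Y i) = 0.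
  elim: n Y => [|n IH] Y Y0; first by rewrite big_ord0.
  by rewrite big_ord_recl PhiD Y0 IH ?addr0.
apply: smooth_fun_ext => -[p1 p2].
have [chi1 [y1 [E1 [c1 F1]]]] := local_frame p1.
have [chi2 [y2 [E2 [c2 F2]]]] := local_frame p2.
pose h f : smooth_fun P := pullback (proj1_map M1 M2) f.
pose v f : smooth_fun P := pullback (proj2_map M1 M2) f.
(* Each half is [local_frame] applied to a projection of X, times the cube belonging to the other
   factor. The coefficients are functions on the product: the projection of X applied to y is X
   applied to the pullback of y. *)
have XE : (h chi1 ^+ 3 * v chi2 ^+ 3) *: X =
    v chi2 ^+ 3 *: (\sum_i (h chi1 * vf_app X (h (y1 i)) - h (y1 i) * vf_app X (h chi1)) *:
       hlift M2 (E1 i)) +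
    h chi1 ^+ 3 *: (\sum_i (v chi2 * vf_app X (v (y2 i)) - v (y2 i) * vf_app X (v chi2)) *:
       vlift M1 (E2 i)).
  apply: vfield_ext => q.
  rewrite vfieldDE !vfieldZE.
  rewrite !vfield_sumE smooth_funME !smooth_funXE.
  apply: prod_tangent_inj; rewrite tangent_mapD !tangent_mapZ !tangent_map_sum.
    rewrite [Z in _ = _ + _ *: Z]big1 ?scaler0 ?addr0 => [|i _]; last first.
      by rewrite tangent_mapZ vlift_proj1 scaler0.
    rewrite mulrC -scalerA [_ *: tangent_map _ _]F1; congr (_ *: _).
    by apply: eq_bigr => i _; rewrite tangent_mapZ hlift_proj1.
  rewrite [Z in _ = _ *: Z + _]big1 ?scaler0 ?add0r => [|i _]; last first.
    by rewrite tangent_mapZ hlift_proj2 scaler0.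
  rewrite -scalerA [_ *: tangent_map _ _]F2; congr (_ *: _).
  by apply: eq_bigr => i _; rewrite tangent_mapZ vlift_proj2.
have := congr1 (fun f : smooth_fun P => f (p1, p2)) (congr1 Phi XE).
rewrite PhiD !PhiZ !PhiS => [|i|i]; [|by rewrite PhiZ PhiV mulr0|by rewrite PhiZ PhiH mulr0].
rewrite !mulr0 addr0 2!smooth_funME !smooth_funXE smooth_fun0E /= => /eqP.
have c12 : chi1 p1 ^+ 3 * chi2 p2 ^+ 3 != 0 by rewrite mulf_neq0 // expf_neq0.
by rewrite mulf_eq0 (negbTE c12) => /eqP.
Qed.

End Product.

(** * Torsion and Codazzi defects as multilinear expressions *)

Section FieldAlgebra.
Context {R : realType} {M : manifold R}.
Implicit Types (X Y Z : vfield M) (f h : smooth_fun M) (g : tensor02 M).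

Lemma vf_appE X f p : vf_app X f p = X p f. Proof. by []. Qed.
Lemma tensor_appE g X Y p : tensor_app g X Y p = g p (X p) (Y p). Proof. by []. Qed.

Lemma vf_app_linearl f X Y h : vf_app (f *: X + Y) h = f * vf_app X h + vf_app Y h.
Proof. exact: smooth_fun_ext. Qed.
Lemma vf_appDl X Y f : vf_app (X + Y) f = vf_app X f + vf_app Y f.
Proof. exact: smooth_fun_ext. Qed.
Lemma vf_appZl h X f : vf_app (h *: X) f = h * vf_app X f.
Proof. exact: smooth_fun_ext. Qed.
Lemma vf_appNl X f : vf_app (- X) f = - vf_app X f.
Proof. by rewrite -scaleN1r vf_appZl mulN1r. Qed.
Lemma vf_appDr X f h : vf_app X (f + h) = vf_app X f + vf_app X h.
Proof. by apply: smooth_fun_ext => p; exact: tangent_add. Qed.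
Lemma vf_appM X f h : vf_app X (f * h) = f * vf_app X h + h * vf_app X f.
Proof. by apply: smooth_fun_ext => p; exact: tangent_mul. Qed.
Lemma vf_appZr X (c : R) f : vf_app X (c *: f) = c *: vf_app X f.
Proof. by apply: smooth_fun_ext => p; exact: tangent_scale. Qed.

Lemma vf_app_ln X f (f0 : forall q, 0 < f q) p :
  vf_app X (ln_fun f0) p = vf_app X f p / f p.
Proof. exact: tangent_ln. Qed.

Lemma tensor_appDl g X Y Z : tensor_app g (X + Y) Z = tensor_app g X Z + tensor_app g Y Z.
Proof. by apply: smooth_fun_ext => p; exact: tensorDl. Qed.
Lemma tensor_appDr g X Y Z : tensor_app g Z (X + Y) = tensor_app g Z X + tensor_app g Z Y.
Proof. by apply: smooth_fun_ext => p; exact: tensorDr. Qed.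
Lemma tensor_appZl g f X Z : tensor_app g (f *: X) Z = f * tensor_app g X Z.
Proof. by apply: smooth_fun_ext => p; exact: tensorZl. Qed.
Lemma tensor_appZr g f X Z : tensor_app g Z (f *: X) = f * tensor_app g Z X.
Proof. by apply: smooth_fun_ext => p; exact: tensorZr. Qed.
Lemma tensor_app_sym g X Y : symmetric_tensor g -> tensor_app g X Y = tensor_app g Y X.
Proof. by move=> gs; apply: smooth_fun_ext => p; exact: gs. Qed.

Definition smooth_funE := (@smooth_funBE R M, @smooth_funDE R M, @smooth_funNE R M,
  @smooth_funME R M, @smooth_funZE R M, @smooth_fun0E R M).

(** This is T(X, Y) f. It is scalar valued because the bracket is an operator on functions rather
    than a field, and because [eq_on_lifts] treats scalar expressions. *)
Definition torsion_defect (nab : connection M) f X Y : smooth_fun M :=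
  vf_app (nab X Y - nab Y X) f - lie_bracket X Y f.

Lemma torsion_defectC nab f X Y : torsion_defect nab f X Y = - torsion_defect nab f Y X.
Proof.
rewrite /torsion_defect /lie_bracket !(vf_appDl, vf_appNl).
apply: smooth_fun_ext => p; rewrite !smooth_funE; ring.
Qed.

Lemma torsion_defect_linear nab f Y h X X' :
  torsion_defect nab f (h *: X + X') Y =
  h * torsion_defect nab f X Y + torsion_defect nab f X' Y.
Proof.
rewrite /torsion_defect /lie_bracket cov_linear_l cov_additive_r cov_leibniz.
rewrite !(vf_appDl, vf_appNl, vf_appZl, vf_appDr, vf_appM).
apply: smooth_fun_ext => p; rewrite !smooth_funE; ring.
Qed.

(** T(X, Y) is not constructed as a tangent vector, so this does not follow from [tangent_cst] in
    one step. It is what will be applied to f2^v and f1^h, constant on slices. *)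
Lemma torsion_defect_cst nab f (a : R) X Y p : (forall q, f q = a) -> torsion_defect nab f X Y p = 0.
Proof.
move=> fa; have f0 Z : vf_app Z f = 0.
  by apply: smooth_fun_ext => q; exact: tangent_cst fa.
have z0 Z : vf_app Z 0 = 0.
  by apply: smooth_fun_ext => q; exact: (@tangent_cst R M q (Z q) 0 0).
by rewrite /torsion_defect /lie_bracket !f0 !z0 !subr0.
Qed.

Definition codazzi_defect nab g X Y Z : smooth_fun M :=
  cov_metric nab g X Y Z - cov_metric nab g Y X Z.

Lemma cov_metricC nab g X Y Z : symmetric_tensor g ->
  cov_metric nab g X Y Z = cov_metric nab g X Z Y.
Proof.
move=> gs; rewrite /cov_metric (tensor_app_sym _ _ gs).
rewrite [tensor_app g (nab X Y) Z](tensor_app_sym _ _ gs).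
rewrite [tensor_app g Y _](tensor_app_sym _ _ gs).
apply: smooth_fun_ext => p; rewrite !smooth_funE; ring.
Qed.

Lemma cov_metric_linear1 nab g f X X' Y Z :
  cov_metric nab g (f *: X + X') Y Z =
  f * cov_metric nab g X Y Z + cov_metric nab g X' Y Z.
Proof.
rewrite /cov_metric !cov_linear_l.
rewrite !(vf_app_linearl, tensor_appDl, tensor_appDr, tensor_appZl, tensor_appZr).
apply: smooth_fun_ext => p; rewrite !smooth_funE; ring.
Qed.

(** The two terms X(f) g(Y, Z), one from differentiating g(fY, Z) and one from the Leibniz rule of
    the connection, cancel. *)
Lemma cov_metric_linear2 nab g f X Y Y' Z :
  cov_metric nab g X (f *: Y + Y') Z =
  f * cov_metric nab g X Y Z + cov_metric nab g X Y' Z.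
Proof.
rewrite /cov_metric cov_additive_r cov_leibniz.
rewrite !(tensor_appDl, tensor_appZl, vf_appDr, vf_appM).
apply: smooth_fun_ext => p; rewrite !smooth_funE; ring.
Qed.

Lemma codazzi_defect_linear1 nab g f X X' Y Z :
  codazzi_defect nab g (f *: X + X') Y Z =
  f * codazzi_defect nab g X Y Z + codazzi_defect nab g X' Y Z.
Proof.
rewrite /codazzi_defect cov_metric_linear1 cov_metric_linear2.
apply: smooth_fun_ext => p; rewrite !smooth_funE; ring.
Qed.

Lemma codazzi_defect_linear3 nab g f X Y Z Z' : symmetric_tensor g ->
  codazzi_defect nab g X Y (f *: Z + Z') =
  f * codazzi_defect nab g X Y Z + codazzi_defect nab g X Y Z'.
Proof.
move=> gs; rewrite /codazzi_defect !(cov_metricC _ _ _ (f *: Z + Z') gs).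
rewrite !cov_metric_linear2 !(cov_metricC _ _ Z _ gs) !(cov_metricC _ _ Z' _ gs).
apply: smooth_fun_ext => p; rewrite !smooth_funE; ring.
Qed.

Lemma codazzi_defectC nab g X Y Z :
  codazzi_defect nab g X Y Z = - codazzi_defect nab g Y X Z.
Proof.
by rewrite /codazzi_defect [RHS]opprB.
Qed.

(** Only the Hessian-like term X(Y(f)) - (nabla_X Y)(f) fails to be symmetric, and its antisymmetric
    part is -T(X, Y) f. This produces the gradient term in the torsion of the induced connection. *)
Lemma warp_form_sym c nab g f X Y : symmetric_tensor g ->
  warp_form c g nab f X Y - warp_form c g nab f Y X =
  - (c *: (f * torsion_defect nab f X Y)).
Proof.
move=> gs; rewrite /warp_form /torsion_defect /lie_bracket (tensor_app_sym _ _ gs).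
rewrite vf_appDl vf_appNl.
apply: smooth_fun_ext => p; rewrite !smooth_funE; ring.
Qed.

End FieldAlgebra.

(** * Brackets of lifts *)

Section LiftBracket.
Context {R : realType} {M1 M2 : manifold R}.
Local Notation P := (prod_manifold M1 M2).
Implicit Types (X : vfield M1) (Y : vfield M2).

(** The lift is an [xget] known only through its two projections, which determine it. Being tangent
    to the slices, it acts on the restriction of a function to a slice as X does. *)
Lemma hlift_slice X (p1 : M1) (p2 : M2) :
  hlift M2 X (p1, p2) = tangent_map (slice1 M1 p2) (X p1).
Proof.
apply: prod_tangent_inj; rewrite lift_projE; apply: tangent_ext => f /=.
  by congr (X p1 _); exact: smooth_fun_ext.
by rewrite (@tangent_cst _ _ _ _ _ (f p2)).
Qed.

Lemma vlift_slice Y (p1 : M1) (p2 : M2) :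
  vlift M1 Y (p1, p2) = tangent_map (slice2 M2 p1) (Y p2).
Proof.
apply: prod_tangent_inj; rewrite lift_projE; apply: tangent_ext => f /=.
  by rewrite (@tangent_cst _ _ _ _ _ (f p1)).
by congr (Y p2 _); exact: smooth_fun_ext.
Qed.

Lemma lie_bracket_hh X X' (f : smooth_fun P) p1 p2 :
  lie_bracket (hlift M2 X) (hlift M2 X') f (p1, p2) =
  lie_bracket X X' (pullback (slice1 M1 p2) f) p1.
Proof.
have E Z : pullback (slice1 M1 p2) (vf_app (hlift M2 Z) f) =
    vf_app Z (pullback (slice1 M1 p2) f).
  by apply: smooth_fun_ext => q; rewrite /= hlift_slice.
rewrite /lie_bracket !smooth_funBE !vf_appE !hlift_slice.
by rewrite -[tangent_map _ _ _]/(X p1 _) E -[tangent_map _ _ _]/(X' p1 _) E.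
Qed.

Lemma lie_bracket_vv Y Y' (f : smooth_fun P) p1 p2 :
  lie_bracket (vlift M1 Y) (vlift M1 Y') f (p1, p2) =
  lie_bracket Y Y' (pullback (slice2 M2 p1) f) p2.
Proof.
have E Z : pullback (slice2 M2 p1) (vf_app (vlift M1 Z) f) =
    vf_app Z (pullback (slice2 M2 p1) f).
  by apply: smooth_fun_ext => q; rewrite /= vlift_slice.
rewrite /lie_bracket !smooth_funBE !vf_appE !vlift_slice.
by rewrite -[tangent_map _ _ _]/(Y p2 _) E -[tangent_map _ _ _]/(Y' p2 _) E.
Qed.

(** In a product chart the components of X^h depend on the left coordinates only, and those of Y^v
    on the right ones. Neither field differentiates the components of the other, so both may be
    frozen and the bracket is a commutator of constant directional derivatives. *)
Lemma lie_bracket_hv X Y (f : smooth_fun P) :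
  lie_bracket (hlift M2 X) (vlift M1 Y) f = 0.
Proof.
apply: smooth_fun_ext => -[p1 p2].
have [a1 A1 d1] := atlas_cover p1; have [a2 A2 d2] := atlas_cover p2.
pose a : chart R (dim P) P := prod_chart a1 a2.
have aP : atlas P a by exists a1, a2.
have ap : chart_dom a (p1, p2) by [].
have [Xi _ XE] := vfieldP X A1; have [Eta _ YE] := vfieldP Y A2.
pose v (x : 'rV[R]_(dim M1 + dim M2)) : 'rV[R]_(dim M1 + dim M2) :=
  row_mx (Xi (lsubmx x)) 0.
pose w (x : 'rV[R]_(dim M1 + dim M2)) : 'rV[R]_(dim M1 + dim M2) :=
  row_mx 0 (Eta (rsubmx x)).
have hE q h : chart_dom a q -> hlift M2 X q h = 'D_(v (a q)) (h \o chart_inv a) (a q).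
  case: q => q1 q2 [/= e1 e2]; rewrite hlift_slice /= XE //; apply: derive_along => t /=.
  rewrite /v row_mxKl scale_row_mx add_row_mx scaler0 add0r.
  by rewrite row_mxKl row_mxKr chart_mapK.
have vE q h : chart_dom a q -> vlift M1 Y q h = 'D_(w (a q)) (h \o chart_inv a) (a q).
  case: q => q1 q2 [/= e1 e2]; rewrite vlift_slice /= YE //; apply: derive_along => t /=.
  rewrite /w row_mxKr scale_row_mx add_row_mx scaler0 add0r.
  by rewrite row_mxKl row_mxKr chart_mapK.
rewrite /lie_bracket smooth_funBE !vf_appE hE // vE //.
set F := f \o chart_inv a.
have -> : 'D_(v (a (p1, p2))) (vf_app (vlift M1 Y) f \o chart_inv a) (a (p1, p2)) =
    'D_(v (a (p1, p2))) ('D_(w (a (p1, p2))) F) (a (p1, p2)).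
  transitivity ('D_(v (a (p1, p2))) (fun x => 'D_(w x) F x) (a (p1, p2))).
    apply: near_eq_derive; apply: near_open (cod_open a) (chart_codP ap) _.
    by move=> _ [q aq <-]; rewrite -[LHS]/(vf_app (vlift M1 Y) f (chart_inv a (a q))) chart_mapK // -vE.
  apply: derive_along => t; congr ('D_(_) F _).
  by rewrite /w /v linearD linearZ /= row_mxKr scaler0 add0r.
have -> : 'D_(w (a (p1, p2))) (vf_app (hlift M2 X) f \o chart_inv a) (a (p1, p2)) =
    'D_(w (a (p1, p2))) ('D_(v (a (p1, p2))) F) (a (p1, p2)).
  transitivity ('D_(w (a (p1, p2))) (fun x => 'D_(v x) F x) (a (p1, p2))).
    apply: near_eq_derive; apply: near_open (cod_open a) (chart_codP ap) _.
    by move=> _ [q aq <-]; rewrite -[LHS]/(vf_app (hlift M2 X) f (chart_inv a (a q))) chart_mapK // -hE.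
  apply: derive_along => t; congr ('D_(_) F _).
  by rewrite /w /v linearD linearZ /= row_mxKl scaler0 add0r.
by rewrite (derive_sym _ _ (cod_open a) (smooth_funP f aP 2) (chart_codP ap)) subrr.
Qed.

End LiftBracket.

(** * The warped metric: values on lifts and positive definiteness *)

(** Otherwise (p + q)^2 <= 4 s^2 <= 4 k p q, against (p + q)^2 = (p - q)^2 + 4 p q; the case p q = 0
    forces s = 0 and is treated apart. *)
Lemma quad_form_gt0 (R : realFieldType) (p q s k : R) : 0 <= p -> 0 <= q ->
  0 < p + q -> k < 1 -> s ^+ 2 <= k * (p * q) -> 0 < p + q + s *+ 2.
Proof.
move=> p0 q0 pq k1 sk; rewrite ltNge; apply/negP => le0.
have H : (p + q) ^+ 2 <= (- (s *+ 2)) ^+ 2.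
  by rewrite lerXn2r ?nnegrE //; [exact: ltW|lra|lra].
have pq0 : 0 <= p * q by exact: mulr_ge0.
have H0 : 0 < (p + q) ^+ 2 by rewrite exprn_gt0.
have H1 : 0 <= (p - q) ^+ 2 by exact: sqr_ge0.
have H2 : 0 <= (1 - k) * (p * q) by rewrite mulr_ge0 // subr_ge0 ltW.
have [pq1|pq1] := eqVneq (p * q) 0; first by rewrite pq1 in sk; lra.
have H3 : 0 < (1 - k) * (p * q) by rewrite mulr_gt0 ?subr_gt0 // lt0r pq1.
lra.
Qed.

Section WarpedMetric.
Context {R : realType} {M1 M2 : manifold R}.
Variables (g1 : tensor02 M1) (g2 : tensor02 M2).
Variables (f1 : smooth_fun M1) (f2 : smooth_fun M2) (c : R).
Local Notation P := (prod_manifold M1 M2).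
Local Notation G := (warped_metric c g1 g2 f1 f2).
Local Notation pi1 := (proj1_map M1 M2).
Local Notation pi2 := (proj2_map M1 M2).
Local Notation hl := (hlift M2).
Local Notation vl := (vlift M1).
Local Notation hf := (@hfun R M1 M2).
Local Notation vf := (@vfun R M1 M2).

Lemma warped_metricE (p : P) (u v : tangent p) :
  G p u v = f2 p.2 ^+ 2 * g1 p.1 (tangent_map pi1 u) (tangent_map pi1 v)
    + f1 p.1 ^+ 2 * g2 p.2 (tangent_map pi2 u) (tangent_map pi2 v)
    + c * (f1 p.1 * f2 p.2) *
      (tangent_map pi1 u f1 * tangent_map pi2 v f2
       + tangent_map pi2 u f2 * tangent_map pi1 v f1).
Proof. by rewrite !expr2. Qed.

Lemma hfunE f (p : P) : hf f p = f p.1. Proof. by []. Qed.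
Lemma vfunE f (p : P) : vf f p = f p.2. Proof. by []. Qed.

Lemma hlift_hfun X f : vf_app (hl X) (hf f) = hf (vf_app X f).
Proof.
apply: smooth_fun_ext => p; rewrite hfunE !vf_appE -hlift_proj1; reflexivity.
Qed.
Lemma hlift_vfun X f : vf_app (hl X) (vf f) = 0.
Proof.
apply: smooth_fun_ext => p; rewrite !vf_appE.
by rewrite -[LHS]/(tangent_map pi2 (hl X p) f) hlift_proj2.
Qed.
Lemma vlift_vfun X f : vf_app (vl X) (vf f) = vf (vf_app X f).
Proof.
apply: smooth_fun_ext => p; rewrite vfunE !vf_appE -vlift_proj2; reflexivity.
Qed.
Lemma vlift_hfun X f : vf_app (vl X) (hf f) = 0.
Proof.
apply: smooth_fun_ext => p; rewrite !vf_appE.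
by rewrite -[LHS]/(tangent_map pi1 (vl X p) f) vlift_proj1.
Qed.

Lemma warped_hh X Y : tensor_app G (hl X) (hl Y) = (vf f2 * vf f2) * hf (tensor_app g1 X Y).
Proof.
apply: smooth_fun_ext => p; rewrite tensor_appE warped_metricE !lift_projE tensor0l.
rewrite !smooth_funME !vfunE hfunE !mulr0 !mul0r !addr0 mulr0 addr0 expr2.
reflexivity.
Qed.

Lemma warped_vv X Y : tensor_app G (vl X) (vl Y) = (hf f1 * hf f1) * vf (tensor_app g2 X Y).
Proof.
apply: smooth_fun_ext => p; rewrite tensor_appE warped_metricE !lift_projE tensor0l.
rewrite !smooth_funME !hfunE vfunE !mulr0 !mul0r !addr0 mulr0 addr0 add0r expr2.
reflexivity.
Qed.

Lemma warped_hv X Y : tensor_app G (hl X) (vl Y) =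
  c *: ((hf f1 * hf (vf_app X f1)) * (vf f2 * vf (vf_app Y f2))).
Proof.
apply: smooth_fun_ext => p; rewrite tensor_appE warped_metricE !lift_projE tensor0l tensor0r.
rewrite smooth_funZE !smooth_funME !hfunE !vfunE !vf_appE /=; ring.
Qed.

Lemma warped_vh X Y : tensor_app G (vl Y) (hl X) =
  c *: ((hf f1 * hf (vf_app X f1)) * (vf f2 * vf (vf_app Y f2))).
Proof.
apply: smooth_fun_ext => p; rewrite tensor_appE warped_metricE !lift_projE tensor0l tensor0r.
rewrite smooth_funZE !smooth_funME !hfunE !vfunE !vf_appE /=; ring.
Qed.

Hypotheses (g1_riem : riemannian g1) (g2_riem : riemannian g2).
Hypotheses (f1_gt0 : forall p1, 0 < f1 p1) (f2_gt0 : forall p2, 0 < f2 p2).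
Hypothesis c_bound : forall (p1 : M1) (p2 : M2),
  0 <= c ^+ 2 * tensor_app g1 (grad g1 f1) (grad g1 f1) p1
              * tensor_app g2 (grad g2 f2) (grad g2 f2) p2 < 1.

(** With p', q' the two diagonal terms of G(u, u) and 2s the cross term, Cauchy-Schwarz for u_i(f_i)
    = g_i(grad f_i, u_i) gives s^2 <= k p' q', where k is the quantity that [c_bound] keeps below
    1. *)
Lemma warped_riemannian : riemannian G.
Proof.
split=> [p u v|p u u0].
  rewrite !warped_metricE (g1_riem.1 _ _ (tangent_map pi1 v)).
  rewrite (g2_riem.1 _ _ (tangent_map pi2 v)); ring.
rewrite warped_metricE; set u1 := tangent_map pi1 u; set u2 := tangent_map pi2 u.
have /andP[_ k1] := c_bound p.1 p.2.
have CS1 := cauchy_schwarz g1_riem (grad g1 f1 p.1) u1.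
have CS2 := cauchy_schwarz g2_riem (grad g2 f2 p.2) u2.
rewrite (gradP f1 (riemannian_pseudo g1_riem)) in CS1.
rewrite (gradP f2 (riemannian_pseudo g2_riem)) in CS2.
rewrite !tensor_appE in k1.
move: CS1 CS2 k1.
have a0 := riemannian_ge0 g1_riem (grad g1 f1 p.1).
have b0 := riemannian_ge0 g2_riem (grad g2 f2 p.2).
set a := g1 _ _ _ in a0 *; set b := g2 _ _ _ in b0 *.
have P0 : 0 <= g1 p.1 u1 u1 by exact: riemannian_ge0.
have Q0 : 0 <= g2 p.2 u2 u2 by exact: riemannian_ge0.
have PQ : g1 p.1 u1 u1 != 0 \/ g2 p.2 u2 u2 != 0.
  have [u10|u1N0] := eqVneq u1 0; last by left; rewrite gt_eqF // g1_riem.2.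
  have [u20|u2N0] := eqVneq u2 0; last by right; rewrite gt_eqF // g2_riem.2.
  case/eqP: u0; apply: prod_tangent_inj; rewrite -/u1 -/u2 ?u10 ?u20; exact: tangent_ext.
move=> CS1 CS2 k1.
have F1 := f1_gt0 p.1; have F2 := f2_gt0 p.2.
set s := c * (f1 p.1 * f2 p.2) * (u1 f1 * u2 f2).
set p' := f2 p.2 ^+ 2 * g1 p.1 u1 u1; set q' := f1 p.1 ^+ 2 * g2 p.2 u2 u2.
have -> : p' + q' + c * (f1 p.1 * f2 p.2) * (u1 f1 * u2 f2 + u2 f2 * u1 f1) = p' + q' + s *+ 2.
  rewrite /s; ring.
have p0 : 0 <= p' by rewrite mulr_ge0 // sqr_ge0.
have q0 : 0 <= q' by rewrite mulr_ge0 // sqr_ge0.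
have pq : 0 < p' + q'.
  rewrite lt_neqAle addr_ge0 // andbT eq_sym paddr_eq0 // negb_and.
  case: PQ => H; apply/orP; [left|right]; by rewrite mulf_neq0 // expf_neq0 // gt_eqF.
have sle : s ^+ 2 <= c ^+ 2 * a * b * (p' * q').
  have : (u1 f1) ^+ 2 * (u2 f2) ^+ 2 <= a * g1 p.1 u1 u1 * (b * g2 p.2 u2 u2).
    by apply: ler_pM; rewrite // sqr_ge0.
  have : 0 <= c ^+ 2 * (f1 p.1 * f2 p.2) ^+ 2 by rewrite mulr_ge0 // sqr_ge0.
  move=> /ler_wpM2l H /H; by congr (_ <= _); rewrite /s /p' /q'; ring.
exact: quad_form_gt0 p0 q0 pq k1 sle.
Qed.

End WarpedMetric.

(** * Covariant derivative of the metric and torsion of the induced connection *)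

Section InducedConnection.
Context {R : realType} {M1 M2 : manifold R}.
Variables (g1 : tensor02 M1) (g2 : tensor02 M2).
Variables (f1 : smooth_fun M1) (f2 : smooth_fun M2) (c : R).
Local Notation P := (prod_manifold M1 M2).
Local Notation G := (warped_metric c g1 g2 f1 f2).
Local Notation pi1 := (proj1_map M1 M2).
Local Notation pi2 := (proj2_map M1 M2).
Local Notation hl := (hlift M2).
Local Notation vl := (vlift M1).
Local Notation hf := (@hfun R M1 M2).
Local Notation vf := (@vfun R M1 M2).

Hypotheses (g1_riem : riemannian g1) (g2_riem : riemannian g2).
Hypotheses (f1_gt0 : forall p1, 0 < f1 p1) (f2_gt0 : forall p2, 0 < f2 p2).
Hypothesis c_bound : forall (p1 : M1) (p2 : M2),
  0 <= c ^+ 2 * tensor_app g1 (grad g1 f1) (grad g1 f1) p1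
              * tensor_app g2 (grad g2 f2) (grad g2 f2) p2 < 1.

Variables (nab1 : connection M1) (nab2 : connection M2) (nab : connection P).
Hypothesis nab_induced : induced_connection c g1 g2 f1_gt0 f2_gt0 nab1 nab2 nab.

Let G_riem : riemannian G.
Proof. exact: warped_riemannian. Qed.

Let gradl f Z : tensor_app G (grad G f) Z = vf_app Z f.
Proof.
by apply: smooth_fun_ext => p; exact: (gradP f (riemannian_pseudo G_riem)).
Qed.

Let gradr f Z : tensor_app G Z (grad G f) = vf_app Z f.
Proof. by rewrite (tensor_app_sym _ _ G_riem.1) gradl. Qed.

Let liftE := (@hlift_hfun R M1 M2, @hlift_vfun R M1 M2, @vlift_vfun R M1 M2,
  @vlift_hfun R M1 M2, @warped_hh R M1 M2, @warped_hv R M1 M2, @warped_vh R M1 M2,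
  @warped_vv R M1 M2, gradl, gradr).

Let tensorE := (@tensor_appDl R P, @tensor_appDr R P, @tensor_appZl R P, @tensor_appZr R P,
  @vf_appM R P, @vf_appZr R P).

(** The correction in nabla_{X^h} Y^h is a multiple of grad(f2^v), which is G-orthogonal to
    horizontal lifts since they annihilate f2^v. *)
Lemma cov_metric_hhh X Y Z : cov_metric nab G (hl X) (hl Y) (hl Z) =
  (vf f2 * vf f2) * hf (cov_metric nab1 g1 X Y Z).
Proof.
have [Hhh _ _ _] := nab_induced; rewrite /cov_metric !Hhh.
rewrite !(tensorE, liftE).
apply: smooth_fun_ext => p; rewrite !(smooth_funE, hfunE, vfunE); ring.
Qed.

Lemma cov_metric_vvv X Y Z : cov_metric nab G (vl X) (vl Y) (vl Z) =
  (hf f1 * hf f1) * vf (cov_metric nab2 g2 X Y Z).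
Proof.
have [_ Hvv _ _] := nab_induced; rewrite /cov_metric !Hvv.
rewrite !(tensorE, liftE).
apply: smooth_fun_ext => p; rewrite !(smooth_funE, hfunE, vfunE); ring.
Qed.

Let f1_neq0 p1 : f1 p1 != 0. Proof. by rewrite gt_eqF. Qed.
Let f2_neq0 p2 : f2 p2 != 0. Proof. by rewrite gt_eqF. Qed.

(** This cancellation accounts for the shape of B: X^h G(Y^h, Z^v) - G(nabla_{X^h} Y^h, Z^v) reduces
    to f2 Z(f2) g1(X, Y), and the logarithmic term of the mixed formula gives the same value for
    G(Y^h, nabla_{X^h} Z^v). *)
Lemma cov_metric_hhv X Y Z : cov_metric nab G (hl X) (hl Y) (vl Z) = 0.
Proof.
have [Hhh _ Hhv _] := nab_induced; rewrite /cov_metric Hhh Hhv /warp_form.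
rewrite !(tensorE, liftE) (tensor_app_sym Y X g1_riem.1).
apply: smooth_fun_ext => p; rewrite !(smooth_funE, hfunE, vfunE, vf_app_ln).
by field; rewrite f1_neq0 f2_neq0.
Qed.

Lemma cov_metric_vvh X Y Z : cov_metric nab G (vl X) (vl Y) (hl Z) = 0.
Proof.
have [_ Hvv _ Hvh] := nab_induced; rewrite /cov_metric Hvv Hvh /warp_form.
rewrite !(tensorE, liftE) (tensor_app_sym Y X g2_riem.1).
apply: smooth_fun_ext => p; rewrite !(smooth_funE, hfunE, vfunE, vf_app_ln).
by field; rewrite f1_neq0 f2_neq0.
Qed.

(** In G(nabla_{X^h} Y^v, Z^v) the gradient term cancels the product of X^h with Z^v, leaving f1
    X(f1) g2(Y, Z). The two connection terms thus share the derivative of f1^2 equally. *)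
Lemma cov_metric_hvv X Y Z : cov_metric nab G (hl X) (vl Y) (vl Z) = 0.
Proof.
have [_ _ Hhv _] := nab_induced; rewrite /cov_metric !Hhv.
rewrite !(tensorE, liftE).
apply: smooth_fun_ext => p; rewrite !(smooth_funE, hfunE, vfunE, vf_app_ln).
by field; rewrite f1_neq0 f2_neq0.
Qed.

Lemma cov_metric_vhh X Y Z : cov_metric nab G (vl X) (hl Y) (hl Z) = 0.
Proof.
have [_ _ _ Hvh] := nab_induced; rewrite /cov_metric !Hvh.
rewrite !(tensorE, liftE).
apply: smooth_fun_ext => p; rewrite !(smooth_funE, hfunE, vfunE, vf_app_ln).
by field; rewrite f1_neq0 f2_neq0.
Qed.

Lemma torsion_defect_hh (F : smooth_fun P) X Y p1 p2 :
  torsion_defect nab F (hl X) (hl Y) (p1, p2) =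
  torsion_defect nab1 (pullback (slice1 M1 p2) F) X Y p1
  - c * f1 p1 * f2 p2 * torsion_defect nab1 f1 X Y p1 * grad G (vf f2) (p1, p2) F.
Proof.
have [Hhh _ _ _] := nab_induced.
rewrite /torsion_defect !Hhh smooth_funBE lie_bracket_hh.
have := congr1 (fun f : smooth_fun M1 => f p1) (warp_form_sym c nab1 f1 X Y g1_riem.1).
rewrite !(smooth_funBE, smooth_funNE, smooth_funZE, smooth_funME) => /eqP.
rewrite subr_eq => /eqP E.
rewrite !(vf_appDl, vf_appNl, vf_appZl) !(smooth_funDE, smooth_funNE, smooth_funME, hfunE, vfunE).
rewrite !vf_appE !hlift_slice E /torsion_defect !(vf_appDl, vf_appNl) !smooth_funE !vf_appE /=; ring.
Qed.

Lemma torsion_defect_vv (F : smooth_fun P) X Y p1 p2 :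
  torsion_defect nab F (vl X) (vl Y) (p1, p2) =
  torsion_defect nab2 (pullback (slice2 M2 p1) F) X Y p2
  - c * f2 p2 * f1 p1 * torsion_defect nab2 f2 X Y p2 * grad G (hf f1) (p1, p2) F.
Proof.
have [_ Hvv _ _] := nab_induced.
rewrite /torsion_defect !Hvv smooth_funBE lie_bracket_vv.
have := congr1 (fun f : smooth_fun M2 => f p2) (warp_form_sym c nab2 f2 X Y g2_riem.1).
rewrite !(smooth_funBE, smooth_funNE, smooth_funZE, smooth_funME) => /eqP.
rewrite subr_eq => /eqP E.
rewrite !(vf_appDl, vf_appNl, vf_appZl) !(smooth_funDE, smooth_funNE, smooth_funME, hfunE, vfunE).
rewrite !vf_appE !vlift_slice E /torsion_defect !(vf_appDl, vf_appNl) !smooth_funE !vf_appE /=; ring.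
Qed.

Lemma torsion_defect_hv (F : smooth_fun P) X Y :
  torsion_defect nab F (hl X) (vl Y) = 0.
Proof.
have [_ _ Hhv Hvh] := nab_induced.
rewrite /torsion_defect lie_bracket_hv Hhv Hvh subrr.
by apply: smooth_fun_ext => p; rewrite subr0.
Qed.

Lemma torsion_free_induced : torsion_free nab1 -> torsion_free nab2 -> torsion_free nab.
Proof.
move=> T1 T2; suff T F X Y : torsion_defect nab F X Y = 0.
  by move=> X Y F; apply/eqP; rewrite -subr_eq0; apply/eqP/T.
have T1' f X1 Y1 p : torsion_defect nab1 f X1 Y1 p = 0.
  by rewrite /torsion_defect T1 subrr.
have T2' f X2 Y2 p : torsion_defect nab2 f X2 Y2 p = 0.
  by rewrite /torsion_defect T2 subrr.
apply: (eq_on_lifts (Phi := fun X => torsion_defect nab F X Y)) => {X}.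
- by move=> f X X'; exact: torsion_defect_linear.
(* Antisymmetry moves the remaining field to the first slot, where linearity is available. *)
- move=> X1; rewrite torsion_defectC; apply/eqP; rewrite oppr_eq0; apply/eqP.
  apply: (eq_on_lifts (Phi := fun Y => torsion_defect nab F Y (hl X1))) => {Y}.
  + by move=> f Y Y'; exact: torsion_defect_linear.
  + move=> Y1; apply: smooth_fun_ext => -[p1 p2].
    by rewrite torsion_defect_hh !T1' mulr0 mul0r subr0.
  + by move=> Y2; rewrite torsion_defectC torsion_defect_hv oppr0.
- move=> X2; rewrite torsion_defectC; apply/eqP; rewrite oppr_eq0; apply/eqP.
  apply: (eq_on_lifts (Phi := fun Y => torsion_defect nab F Y (vl X2))) => {Y}.
  + by move=> f Y Y'; exact: torsion_defect_linear.
  + by move=> Y1; rewrite torsion_defect_hv.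
  + move=> Y2; apply: smooth_fun_ext => -[p1 p2].
    by rewrite torsion_defect_vv !T2' mulr0 mul0r subr0.
Qed.

Lemma codazzi_induced :
  (forall X Y Z, cov_metric nab1 g1 X Y Z = cov_metric nab1 g1 Y X Z) ->
  (forall X Y Z, cov_metric nab2 g2 X Y Z = cov_metric nab2 g2 Y X Z) ->
  forall X Y Z, cov_metric nab G X Y Z = cov_metric nab G Y X Z.
Proof.
move=> C1 C2.
(* By antisymmetry this serves both orders of a mixed pair; symmetry of nabla G in its last two
   slots brings each term to one of the four vanishing mixed types. *)
have hvE X Y Z : codazzi_defect nab G (hl X) (vl Y) Z = 0.
  apply: (eq_on_lifts (Phi := codazzi_defect nab G (hl X) (vl Y))) => {Z}.
  - by move=> f Z Z'; exact: codazzi_defect_linear3 G_riem.1.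
  - move=> Z; rewrite /codazzi_defect cov_metric_vhh.
    by rewrite (cov_metricC _ _ _ _ G_riem.1) cov_metric_hhv subrr.
  - move=> Z; rewrite /codazzi_defect cov_metric_hvv.
    by rewrite (cov_metricC _ _ _ _ G_riem.1) cov_metric_vvh subrr.
suff C X Y Z : codazzi_defect nab G X Y Z = 0.
  by move=> X Y Z; apply/eqP; rewrite -subr_eq0; apply/eqP/C.
apply: (eq_on_lifts (Phi := fun X => codazzi_defect nab G X Y Z)) => {X}.
- by move=> f X X'; exact: codazzi_defect_linear1.
- move=> X; rewrite codazzi_defectC; apply/eqP; rewrite oppr_eq0; apply/eqP.
  apply: (eq_on_lifts (Phi := fun Y => codazzi_defect nab G Y (hl X) Z)) => {Y}.
  + by move=> f Y Y'; exact: codazzi_defect_linear1.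
  + move=> Y; apply: (eq_on_lifts (Phi := codazzi_defect nab G (hl Y) (hl X))) => {Z}.
    * by move=> f Z Z'; exact: codazzi_defect_linear3 G_riem.1.
    * by move=> Z; rewrite /codazzi_defect !cov_metric_hhh (C1 X) subrr.
    * by move=> Z; rewrite /codazzi_defect !cov_metric_hhv subrr.
  + by move=> Y; rewrite codazzi_defectC hvE oppr0.
- move=> X; rewrite codazzi_defectC; apply/eqP; rewrite oppr_eq0; apply/eqP.
  apply: (eq_on_lifts (Phi := fun Y => codazzi_defect nab G Y (vl X) Z)) => {Y}.
  + by move=> f Y Y'; exact: codazzi_defect_linear1.
  + by move=> Y; exact: hvE.
  + move=> Y; apply: (eq_on_lifts (Phi := codazzi_defect nab G (vl Y) (vl X))) => {Z}.
    * by move=> f Z Z'; exact: codazzi_defect_linear3 G_riem.1.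
    * by move=> Z; rewrite /codazzi_defect !cov_metric_vvh subrr.
    * by move=> Z; rewrite /codazzi_defect !cov_metric_vvv (C2 X) subrr.
Qed.

(* A nonzero defect of nab1 would be a multiple of the first component of
   k grad(f2^v), whose second component, hence whose derivative of f2^v, vanishes;
   but the latter is the squared length of k grad(f2^v), up to the factor k. *)
Lemma torsion_free_base1 : torsion_free nab -> torsion_free nab1.
Proof.
move=> T X Y f; apply/eqP; rewrite -subr_eq0; apply/eqP/smooth_fun_ext => p1.
rewrite -[LHS]/(torsion_defect nab1 f X Y p1) smooth_fun0E.
have [p2 _] := manifold_nonempty M2.
set W := grad G (vf f2) (p1, p2).
set k := c * f1 p1 * f2 p2 * torsion_defect nab1 f1 X Y p1.
have E F : torsion_defect nab1 (pullback (slice1 M1 p2) F) X Y p1 = k * W F.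
  apply/eqP; rewrite -subr_eq0; apply/eqP; rewrite -torsion_defect_hh.
  by rewrite /torsion_defect T subrr.
have kWf2 : (k *: W) (vf f2) = 0.
  by rewrite tangentZE -E; apply: (@torsion_defect_cst _ _ _ _ (f2 p2)).
have kW0 : k *: W = 0.
  apply/eqP; apply: contraT => /(G_riem.2 (p1, p2)).
  by rewrite tensorZl (gradP _ (riemannian_pseudo G_riem)) kWf2 mulr0 ltxx.
have -> : f = pullback (slice1 M1 p2) (hf f) by exact: smooth_fun_ext.
by rewrite E -tangentZE kW0.
Qed.

Lemma torsion_free_base2 : torsion_free nab -> torsion_free nab2.
Proof.
move=> T X Y f; apply/eqP; rewrite -subr_eq0; apply/eqP/smooth_fun_ext => p2.
rewrite -[LHS]/(torsion_defect nab2 f X Y p2) smooth_fun0E.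
have [p1 _] := manifold_nonempty M1.
set W := grad G (hf f1) (p1, p2).
set k := c * f2 p2 * f1 p1 * torsion_defect nab2 f2 X Y p2.
have E F : torsion_defect nab2 (pullback (slice2 M2 p1) F) X Y p2 = k * W F.
  apply/eqP; rewrite -subr_eq0; apply/eqP; rewrite -torsion_defect_vv.
  by rewrite /torsion_defect T subrr.
have kWf1 : (k *: W) (hf f1) = 0.
  by rewrite tangentZE -E; apply: (@torsion_defect_cst _ _ _ _ (f1 p1)).
have kW0 : k *: W = 0.
  apply/eqP; apply: contraT => /(G_riem.2 (p1, p2)).
  by rewrite tensorZl (gradP _ (riemannian_pseudo G_riem)) kWf1 mulr0 ltxx.
have -> : f = pullback (slice2 M2 p1) (vf f) by exact: smooth_fun_ext.
by rewrite E -tangentZE kW0.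
Qed.

(** Horizontal triples recover nabla_1 g1 up to the nonzero factor f2(p2)^2; some p2 exists because
    M2 is nonempty. *)
Lemma codazzi_base1 :
  (forall X Y Z, cov_metric nab G X Y Z = cov_metric nab G Y X Z) ->
  forall X Y Z, cov_metric nab1 g1 X Y Z = cov_metric nab1 g1 Y X Z.
Proof.
move=> C X Y Z; apply: smooth_fun_ext => p1.
have [p2 _] := manifold_nonempty M2.
have := congr1 (fun h : smooth_fun P => h (p1, p2)) (C (hl X) (hl Y) (hl Z)).
rewrite !cov_metric_hhh 2!smooth_funME !hfunE smooth_funME !vfunE /=.
by apply: mulfI; rewrite mulf_neq0.
Qed.

Lemma codazzi_base2 :
  (forall X Y Z, cov_metric nab G X Y Z = cov_metric nab G Y X Z) ->
  forall X Y Z, cov_metric nab2 g2 X Y Z = cov_metric nab2 g2 Y X Z.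
Proof.
move=> C X Y Z; apply: smooth_fun_ext => p2.
have [p1 _] := manifold_nonempty M1.
have := congr1 (fun h : smooth_fun P => h (p1, p2)) (C (vl X) (vl Y) (vl Z)).
rewrite !cov_metric_vvv 2!smooth_funME !vfunE smooth_funME !hfunE /=.
by apply: mulfI; rewrite mulf_neq0.
Qed.

End InducedConnection.

Theorem proposition4 (R : realType) (M1 M2 : manifold R)
    (g1 : tensor02 M1) (g2 : tensor02 M2)
    (g1_riem : riemannian g1) (g2_riem : riemannian g2)
    (f1 : smooth_fun M1) (f2 : smooth_fun M2)
    (f1_gt0 : forall p1, 0 < f1 p1) (f2_gt0 : forall p2, 0 < f2 p2)
    (c : R)
    (c_bound : forall (p1 : M1) (p2 : M2),
      0 <= c ^+ 2 * tensor_app g1 (grad g1 f1) (grad g1 f1) p1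
                  * tensor_app g2 (grad g2 f2) (grad g2 f2) p2 < 1)
    (nab1 : connection M1) (nab2 : connection M2)
    (nab : connection (prod_manifold M1 M2))
    (nab_induced :
      induced_connection c g1 g2 f1_gt0 f2_gt0 nab1 nab2 nab) :
  (statistical_manifold nab1 g1 /\ statistical_manifold nab2 g2) <->
  statistical_manifold nab (warped_metric c g1 g2 f1 f2).
Proof.
have G_riem := warped_riemannian g1_riem g2_riem f1_gt0 f2_gt0 c_bound.
split=> [[[_ T1 C1] [_ T2 C2]]|[_ T C]].
  (* In both directions the clause on the metric follows from positive definiteness. *)
  split; first exact: riemannian_pseudo.
    exact: (torsion_free_induced g1_riem g2_riem nab_induced).
  exact: (codazzi_induced g1_riem g2_riem c_bound nab_induced).
split; split; try exact: riemannian_pseudo.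
- exact: (torsion_free_base1 g1_riem g2_riem c_bound nab_induced).
- exact: (codazzi_base1 g1_riem g2_riem c_bound nab_induced).
- exact: (torsion_free_base2 g1_riem g2_riem c_bound nab_induced).
- exact: (codazzi_base2 g1_riem g2_riem c_bound nab_induced).
Qed.
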